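(* Let $f\in C_0^{\infty}(\mathbb{R}^3)$, let $p\in C^{1}([0,\frac{\pi}{2}])$ be a curve, and let $w=w(r,\varphi)$ be a weighting. Then for all $r\in[0,1]$ and all integers $l\ge 0$, $|m|\le l$, $$(\mathcal{S}_{w,p}f)_{lm}(r)=2\pi\int_{0}^{\pi}w(r,\varphi)\,\rho\sin\varphi\,\sqrt{\rho^2+\left(\frac{\mathrm{d}\rho}{\mathrm{d}\varphi}\right)^2}\;F_{lm}(\rho)\,P_l(\cos\varphi)\Big|_{\rho=\rho(r,\varphi)}\,\mathrm{d}\varphi ,$$ where $$(\mathcal{S}_{w,p}f)_{lm}(r)=\int_{S^2}(\mathcal{S}_{w,p}f)(r,\cdot)\,\bar{Y}_l^m\,\mathrm{d}\tau ,$$ $P_l$ is the Legendre polynomial of degree $l$, and $F_{lm}$ are the harmonic coefficients of $f$.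
   Context: Polar form: for $f:\mathbb{R}^3\to\mathbb{R}$ write $F(\rho,\theta,\varphi)=f(\rho\sin\varphi\cos\theta,\rho\sin\varphi\sin\theta,\rho\cos\varphi)$, where $\theta\in[0,2\pi]$ is the azimuth and $\varphi\in[0,\pi]$ the colatitude; $C_0^\infty$ denotes smooth compactly supported real-valued functions. Rotations: $h=U(\alpha)V(\beta)\in \mathrm{SO}(3)$, where $U(\alpha)$ and $V(\beta)$ are the rotations about the $x_3$- and $x_2$-axis by angles $\alpha\in[0,2\pi]$, $\beta\in[0,\pi]$ respectively, so that $h(0,0,1)^T=(\sin\beta\cos\alpha,\sin\beta\sin\alpha,\cos\beta)^T$. The pair $(\alpha,\beta)$ is identified with this point of $S^2$ (azimuth $\alpha$, colatitude $\beta$). The action is $(h\cdot f)(x)=f(hx)$, and $h\cdot F$ is the polar form of $h\cdot f$. Spherical harmonics: for integers $l\ge0$, $|m|\le l$, $$Y_l^m(\theta,\varphi)=(-1)^m\sqrt{\tfrac{(2l+1)(l-m)!}{4\pi(l+m)!}}\,P_l^m(\cos\varphi)e^{\mathrm{i}m\theta},\quad P_l^m(x)=(-1)^m(1-x^2)^{m/2}\tfrac{\mathrm{d}^m}{\mathrm{d}x^m}P_l(x),$$ $$P_l(x)=\frac1{2^l}\sum_{k=0}^l\binom lk^2(x-1)^{l-k}(x+1)^k$$ (with the usual convention $P_l^{-m}=(-1)^m\frac{(l-m)!}{(l+m)!}P_l^m$ for negative orders). They are orthonormal in $L^2(S^2)$ with surface measure $\mathrm{d}\tau=\sin\varphi\,\mathrm{d}\theta\,\mathrm{d}\varphi$.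 The harmonic coefficients of $f$ are $F_{lm}(\rho)=\int_{S^2}F(\rho,\cdot)\bar Y_l^m\,\mathrm{d}\tau$. Symmetric curves: given $p\in C^1([0,\frac\pi2])$, viewed as a curve with polar radius $p(\varphi)\ge0$ at colatitude $\varphi$, set $\rho(r,\varphi)=p(\sin^{-1}(r\sin\varphi))$ for $(r,\varphi)\in[0,1]\times[0,\pi]$. Generalized spindle transform: for a weighting $w:[0,1]\times[0,\pi]\to\mathbb{R}$ depending only on $r$ and $\varphi$ (with $w(r,\cdot)$ integrable on $[0,\pi]$ for each $r$, so that the integrals make sense), $$\mathcal{S}_{w,p}f(r,\alpha,\beta)=\int_{0}^{2\pi}\int_{0}^{\pi}w(r,\varphi)\rho\sin\varphi\sqrt{\rho^2+\left(\tfrac{\mathrm{d}\rho}{\mathrm{d}\varphi}\right)^2}\,(h\cdot F)(\rho,\theta,\varphi)\Big|_{\rho=\rho(r,\varphi)}\mathrm{d}\varphi\,\mathrm{d}\theta,\qquad h=U(\alpha)V(\beta).$$ *)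

(* Defs.v *)
From HB Require Import structures.
From mathcomp Require Import all_boot all_order all_algebra.
From mathcomp Require Import all_classical all_reals all_analysis.
From mathcomp Require Export complex.

Set Implicit Arguments.
Unset Strict Implicit.
Unset Printing Implicit Defensive.

Import Order.TTheory GRing.Theory Num.Theory.
Import numFieldNormedType.Exports.

Local Open Scope classical_set_scope.
Local Open Scope ring_scope.
Local Open Scope complex_scope.

Section points_and_rotations.
Context {R : realType}.

Definition polar_point (rho theta phi : R) : 'cV[R]_3 :=
  \col_(i < 3) [:: rho * sin phi * cos theta;
                   rho * sin phi * sin theta;
                   rho * cos phi]`_i.

Definition polar_form (f : 'cV[R]_3 -> R) (rho theta phi : R) : R :=
  f (polar_point rho theta phi).

Definition rotU (alpha : R) : 'M[R]_3 :=
  \matrix_(i < 3, j < 3)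
    (nth [::] [:: [:: cos alpha; - sin alpha; 0];
                  [:: sin alpha;   cos alpha; 0];
                  [:: 0;           0;         1]] i)`_j.

(* Oriented so that rotU alpha *m rotV beta maps the north pole to the point of
   azimuth alpha and colatitude beta. *)
Definition rotV (beta : R) : 'M[R]_3 :=
  \matrix_(i < 3, j < 3)
    (nth [::] [:: [::   cos beta; 0; sin beta];
                  [:: 0;          1; 0];
                  [:: - sin beta; 0; cos beta]] i)`_j.

Definition act (h : 'M[R]_3) (f : 'cV[R]_3 -> R) (x : 'cV[R]_3) : R :=
  f (h *m x).

End points_and_rotations.

Section regularity.
Context {R : realType}.

Fixpoint iter_partial (s : seq 'I_3) (f : 'cV[R]_3 -> R) : 'cV[R]_3 -> R :=
  if s is i :: s' then fun x => 'D_(delta_mx i 0) (iter_partial s' f) x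
  else f.

Definition smooth (f : 'cV[R]_3 -> R) : Prop :=
  forall s : seq 'I_3,
    continuous (iter_partial s f) /\
    forall (i : 'I_3) (x : 'cV[R]_3),
      derivable (iter_partial s f) x (delta_mx i 0).

Definition compactly_supported (f : 'cV[R]_3 -> R) : Prop :=
  compact (closure [set x | f x != 0]).

(* C^1 on the closed interval, with one-sided derivatives at the endpoints;
   the values of [p] outside [`[a, b]] are irrelevant. *)
Definition C1_on (a b : R) (p : R -> R) : Prop :=
  exists dp : R -> R,
    {within `[a, b], continuous dp} /\
    forall x, x \in `[a, b] ->
      (p y - p x) / (y - x) @[y --> within `[a, b] x^'] --> dp x.

End regularity.

Section harmonics.
Context {R : realType}.

Definition legendre (l : nat) : {poly R} :=
  (2 ^+ l)^-1 *:
    \sum_(k < l.+1) ('C(l, k) ^ 2)%:R *: (('X - 1) ^+ (l - k) * ('X + 1) ^+ k).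

(* Order m >= 0; [Num.sqrt (1 - x ^+ 2) ^+ m] is (1 - x^2)^(m/2) for x in
   [-1, 1]. *)
Definition assoc_legendre_nat (l m : nat) (x : R) : R :=
  (-1) ^+ m * Num.sqrt (1 - x ^+ 2) ^+ m * ((legendre l)^`(m)).[x].

Definition assoc_legendre (l : nat) (m : int) (x : R) : R :=
  match m with
  | Posz k => assoc_legendre_nat l k x
  | Negz k => (-1) ^+ k.+1 * ((l - k.+1)`!%:R / (l + k.+1)`!%:R)
              * assoc_legendre_nat l k.+1 x
  end.

(* For |m| <= l both [l - m] and [l + m] are nonnegative, so that the absolute
   values only convert them to [nat]. *)
Definition sph_harm (l : nat) (m : int) (theta phi : R) : R[i] :=
  ((-1) ^ m
   * Num.sqrt (((2 * l + 1)%:R * (absz (l%:Z - m))`!%:R)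
               / (4 * pi * (absz (l%:Z + m))`!%:R))
   * assoc_legendre l m (cos phi))%:C
  * (cos (m%:~R * theta) +i* sin (m%:~R * theta)).

Definition Cintegral d (T : measurableType d) (mu : {measure set T -> \bar R})
    (D : set T) (g : T -> R[i]) : R[i] :=
  (\int[mu]_(x in D) complex.Re (g x)) +i* (\int[mu]_(x in D) complex.Im (g x)).

Let leb := @lebesgue_measure R.

(* Integral over S^2 for d tau = sin phi d theta d phi, functions on the sphere
   being given in the coordinates (azimuth, colatitude). *)
Definition sphere_integral (g : R -> R -> R[i]) : R[i] :=
  Cintegral (leb \x leb)%E (`[0, 2 * pi] `*` `[0, pi])
    (fun z => g z.1 z.2 * (sin z.2)%:C).

Definition harm_coef (l : nat) (m : int) (g : R -> R -> R) : R[i] :=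
  sphere_integral
    (fun theta phi => (g theta phi)%:C * (sph_harm l m theta phi)^*).

Definition curve_radius (p : R -> R) (r phi : R) : R := p (asin (r * sin phi)).

(* w(r, phi) rho sin phi sqrt (rho^2 + (d rho / d phi)^2) at
   rho = rho(r, phi).  The derivative exists for all phi in ]0, pi[, except
   possibly phi = pi / 2 when r = 1; its value by convention there and at the
   endpoints does not affect the integrals. *)
Definition curve_density (w : R -> R -> R) (p : R -> R) (r phi : R) : R :=
  w r phi * curve_radius p r phi * sin phi
  * Num.sqrt (curve_radius p r phi ^+ 2
              + (derive1 (curve_radius p r) phi) ^+ 2).

Definition spindle (w : R -> R -> R) (p : R -> R) (f : 'cV[R]_3 -> R)
    (r alpha beta : R) : R :=
  \int[leb]_(theta in `[0, 2 * pi]) \int[leb]_(phi in `[0, pi])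
    (curve_density w p r phi *
     polar_form (act (rotU alpha *m rotV beta) f)
       (curve_radius p r phi) theta phi).

End harmonics.

(* Main.v *)
Require Import Defs.
From mathcomp Require Import all_boot all_order all_algebra.
From mathcomp Require Import all_classical all_reals all_analysis.
From mathcomp Require Import measurable_realfun complex ring lra.

Set Implicit Arguments.
Unset Strict Implicit.
Unset Printing Implicit Defensive.

Import Order.TTheory GRing.Theory Num.Theory.
Import numFieldNormedType.Exports.

Local Open Scope classical_set_scope.
Local Open Scope ring_scope.
Local Open Scope complex_scope.

(** Fix the radius: put g(x) = f(rho x) on the unit sphere, and let k be the
    conjugate of a spherical harmonic of degree l. For a rotation h that takes
    the north pole to x, the points h (phi, theta) of colatitude phi run, as
    theta varies, over the circle of points at angular distance phi from x. The
    transform is thus the integral over phi, against the density, of the circle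
    means M_phi g (x), and the theorem is the Funk-Hecke formula
      integral of (M_phi g) k = 2 pi P_l(cos phi) (integral of g k)
    integrated in phi, by Fubini ([spindle_funk_hecke]). Two facts give the
    formula ([funk_hecke]).

    (1) M_phi is symmetric ([circle_mean_symmetric]). The integral over all
    rotations h, in Euler angles, of g(h V(phi - t) e3) k(h V(- t) e3) has a
    derivative in t which is the integral of a divergence, hence zero
    ([integral3_divergence]); the values at t = 0 and t = phi are the two sides.

    (2) M_phi k = 2 pi P_l(cos phi) k ([solid_harm_orbit_average]). It suffices
    to treat k(x) = (e . x)^l for complex vectors e with e . e = 0. In a frame
    whose pole is the centre of the circle e . x is a trigonometric polynomial
    A exp(- i theta) + B + D exp(i theta), where B = e3 cos phi and
    A D = - (e3 sin phi)^2 / 4. The mean of its power is the coefficient of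
    degree l of (A + B w + D w^2)^l, which only depends on B and A D
    ([coef_trinomial_exp_monic]) and is homogeneous in e3; the remaining factor
    is P_l(cos phi) by the Rodrigues formula ([horner_legendre]).

    The harmonics are reached as follows. For the null vectors
    e = (t^2 - 1, - i (t^2 + 1), 2 t) the powers (e . x)^l are polynomials in t
    whose coefficients ([solid_harm]) restrict on the sphere to multiples of the
    conjugates of the Y_l^m, m >= 0 ([solid_harm_polar]); by interpolation at
    2 l + 1 values of t these coefficients are combinations of powers of null
    forms ([solid_harm_null_forms]). Everything is done with the real parts of
    complex multiples of harmonics, which yields the real and the imaginary part
    of the statement.

    The exchange of integrals needs the density to be integrable
    ([curve_density_integrable]): the angle asin (r sin phi) has speed at most
    1, so that w is multiplied by a bounded function. *)

(** * Integration of continuous functions of several variables *)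

Section continuous_integrals.
Context {R : realType}.
Local Notation leb := (@lebesgue_measure R).
Implicit Types a b c d : R.

Lemma continuous_pair (T U V : topologicalType) (f : T -> U) (g : T -> V) :
  continuous f -> continuous g -> continuous (fun t => (f t, g t)).
Proof. by move=> cf cg t; apply: cvg_pair; [exact: cf|exact: cg]. Qed.

Lemma continuous_comp2 (T U V W : topologicalType) (K : U -> V -> W)
    (f : T -> U) (g : T -> V) :
  continuous (fun z : U * V => K z.1 z.2) -> continuous f -> continuous g ->
  continuous (fun t => K (f t) (g t)).
Proof.
move=> cK cf cg t.
apply: (@continuous_comp _ _ _ (fun t => (f t, g t)) (fun z => K z.1 z.2)).
  exact: continuous_pair.
exact: cK.
Qed.

(** Every open set of the plane is the union of its countably many rational
    open rectangles, so that continuity implies measurability for the product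
    sigma-algebra. *)
Lemma measurable_continuous_plane (f : R * R -> R) :
  continuous f -> measurable_fun setT f.
Proof.
move=> /continuousP cf.
apply: (measurability _ (RGenOpens.measurableE R)) => _ [_ [u [v ->]] <-].
rewrite setTI; have {cf} : open (f @^-1` `]u, v[) by exact/cf/interval_open.
move: (f @^-1` _) => U oU.
pose box (q : rat * rat * (rat * rat)) : set (R * R) :=
  `]ratr q.1.1, ratr q.1.2[%classic `*` `]ratr q.2.1, ratr q.2.2[%classic.
have -> : U = \bigcup_(q in [set q | box q `<=` U]) box q.
  apply/seteqP; split => [[x y] Uxy|z [q qU]]; last exact: qU.
  have /nbhs_ballP[e /= e0 eU] : nbhs (x, y) U by exact: open_nbhs_nbhs.
  have [q1 +] := @rat_in_itvoo R (x - e) x ltac:(by rewrite ltrBlDr ltrDl).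
  rewrite in_itv/= => /andP[q1e q1x].
  have [q2 +] := @rat_in_itvoo R x (x + e) ltac:(by rewrite ltrDl).
  rewrite in_itv/= => /andP[q2x q2e].
  have [q3 +] := @rat_in_itvoo R (y - e) y ltac:(by rewrite ltrBlDr ltrDl).
  rewrite in_itv/= => /andP[q3e q3x].
  have [q4 +] := @rat_in_itvoo R y (y + e) ltac:(by rewrite ltrDl).
  rewrite in_itv/= => /andP[q4x q4e].
  exists ((q1, q2), (q3, q4)); last first.
    by rewrite /box/=; split; rewrite /= in_itv/=; apply/andP; split.
  move=> [s t] [/=]; rewrite !in_itv/= => /andP[s1 s2] /andP[t1 t2].
  by apply: eU; split; rewrite /= /ball/= ltr_norml; apply/andP; split; lra.
rewrite bigcup_mkcond; apply: countable_bigcupT_measurable => [|q].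
  exact: countableP.
case: ifP => _; last exact: measurable0.
by apply: measurableX; exact: measurable_itv.
Qed.


Lemma continuous_rectangle_bounded a b c d (K : R -> R -> R) :
  continuous (fun z : R * R => K z.1 z.2) ->
  exists2 M, 0 <= M &
    forall x y, x \in `[a, b] -> y \in `[c, d] -> `|K x y| <= M.
Proof.
move=> cK; have : compact ((fun z : R * R => K z.1 z.2) @`
    (`[a, b]%classic `*` `[c, d]%classic)).
  apply: continuous_compact; first exact: continuous_subspaceT.
  by apply: compact_setX; exact: segment_compact.
move=> /compact_bounded[M [_ MK]]; exists (`|M| + 1); first by rewrite addr_ge0.
move=> x y xab ycd; apply: MK; last by exists (x, y).
by rewrite ltr_pwDr// ler_norm.
Qed.

Lemma integrable_continuous a b (g : R -> R) :
  continuous g -> leb.-integrable `[a, b] (EFin \o g).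
Proof.
move=> cg; apply: continuous_compact_integrable; first exact: segment_compact.
exact: continuous_subspaceT.
Qed.

Lemma integrable_weighted c d (D g : R -> R) :
  leb.-integrable `[c, d] (EFin \o D) -> continuous g ->
  leb.-integrable `[c, d] (EFin \o (fun y => D y * g y)).
Proof.
move=> iD cg.
have : compact (g @` `[c, d]%classic).
  apply: continuous_compact; first exact: continuous_subspaceT.
  exact: segment_compact.
move=> /compact_bounded[M [_ MK]].
pose M' := `|M| + 1.
have Mg y : `[c, d]%classic y -> `|g y| <= M'.
  by move=> ycd; apply: MK; [rewrite ltr_pwDr// ler_norm|exists y].
have M'0 : 0 <= M' by rewrite addr_ge0.
have iM : leb.-integrable `[c, d] (fun y => M'%:E * (EFin \o D) y)%E.
  exact: integrableZl.
apply: le_integrable iM => //.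
- apply/measurable_EFinP; apply: measurable_funM.
    by apply/measurable_EFinP; case/integrableP : iD.
  by apply: measurable_funS (continuous_measurable_fun cg).
- move=> y ycd /=; rewrite lee_fin !normrM mulrC.
  by apply: ler_pM => //; rewrite [leRHS]ger0_norm ?Mg.
Qed.

(** Continuity of a parametric integral, for a fixed integrable density. By
    compactness of the interval of integration the integrand is close to its
    value at the given parameter, uniformly in the integration variable. *)
Lemma continuous_Rintegral_param (T : topologicalType) c d (D : R -> R)
    (K : T -> R -> R) :
  leb.-integrable `[c, d] (EFin \o D) ->
  continuous (fun z : T * R => K z.1 z.2) ->
  continuous (fun t => \int[leb]_(y in `[c, d]) (D y * K t y)).
Proof.
move=> iD cK t0.
have cKt t : continuous (K t).
  by apply: continuous_comp2 cK _ _ => y; [exact: cvg_cst|exact: cvg_id].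
have iDn : leb.-integrable `[c, d] (EFin \o (fun y => `|D y|)).
  exact: (integrable_norm iD).
set C := \int[leb]_(y in `[c, d]) `|D y|.
have C0 : 0 <= C by apply: Rintegral_ge0 => y _; exact: normr_ge0.
apply/cvgrPdist_lt => e e0.
have e'0 : 0 < e / (C + 1) by rewrite divr_gt0// ltr_wpDl.
have : \forall t \near t0, `[c, d]%classic `<=`
    (fun y => `|K t0 y - K t y| < e / (C + 1)).
  have /compact_near_coveringP := @segment_compact R c d.
  apply => y ycd.
  have /cvgrPdist_lt cKy := cK (t0, y).
  have h0 : 0 < e / (C + 1) / 2 by rewrite divr_gt0.
  have {cKy}[[A B] /= [At By] AB] := cKy _ h0.
  have /cvgrPdist_lt/(_ _ h0) K0 := cKt t0 y.
  exists ((fun y' => B y' /\ `|K t0 y - K t0 y'| < e / (C + 1) / 2), A) => /=.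
    by split => //=; apply: filterI.
  move=> [y' t] /= [[By' h1] At'].
  have /= h2 := AB (t, y') (conj At' By').
  rewrite -(subrK (K t0 y) (K t0 y')) -addrA.
  rewrite (le_lt_trans (ler_normD _ _))// (splitr (e / (C + 1))) ltrD//.
  by rewrite distrC.
apply: filterS => t Kt.
rewrite -RintegralB//; [|exact: integrable_weighted..].
have -> : \int[leb]_(y in `[c, d]) (D y * K t0 y - D y * K t y) =
    \int[leb]_(y in `[c, d]) (D y * (K t0 y - K t y)).
  by apply: eq_Rintegral => y _; rewrite mulrBr.
have cKK : continuous (fun y => K t0 y - K t y).
  by move=> y; apply: cvgB; exact: cKt.
apply: (@le_lt_trans _ _ (\int[leb]_(y in `[c, d]) (`|D y| * (e / (C + 1))))).
  apply: le_trans (le_normr_Rintegral _ _) _ => //.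
    exact: integrable_weighted.
  apply: le_Rintegral => //.
  - exact/integrable_norm/integrable_weighted.
  - by apply: integrable_weighted => // y; exact: cvg_cst.
  - by move=> y ycd; rewrite normrM ler_wpM2l// ltW// Kt.
rewrite RintegralZr// -/C mulrA ltr_pdivrMr ?ltr_wpDl//.
by rewrite mulrC ltr_pM2l// ltrDl.
Qed.

End continuous_integrals.

Section continuous_fubini.
Context {R : realType}.
Local Notation leb := (@lebesgue_measure R).
Implicit Types a b c d : R.

Lemma integral_restrict_scale c d (g : R -> R) (k : R) :
  leb.-integrable `[c, d] (EFin \o g) ->
  (\int[leb]_y (k * (g \_ `[c, d]) y)%:E =
   (k * \int[leb]_(y in `[c, d]) g y)%:E)%E.
Proof.
move=> ig.
have ig' : leb.-integrable setT (EFin \o (g \_ `[c, d])).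
  by rewrite -restrict_EFin; apply/integrable_restrict => //=; rewrite setTI.
rewrite Rintegral_mkcond -RintegralZl//.
rewrite /Rintegral fineK//; apply: integrable_fin_num => //.
rewrite (_ : (fun _ => _) = (fun y => k%:E * (EFin \o (g \_ `[c, d])) y)%E) //.
exact: integrableZl.
Qed.

Lemma integrable_weighted_rectangle a b c d (D : R -> R) (K : R -> R -> R) :
  leb.-integrable `[c, d] (EFin \o D) ->
  continuous (fun z : R * R => K z.1 z.2) ->
  (leb \x leb)%E.-integrable setT
    (fun z => ((\1_(`[a, b]) z.1 * (D \_ `[c, d]) z.2) * K z.1 z.2)%:E).
Proof.
move=> iD cK.
have iD' : leb.-integrable setT (EFin \o (D \_ `[c, d])).
  by rewrite -restrict_EFin; apply/integrable_restrict => //=; rewrite setTI.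
have mf : measurable_fun setT
    (fun z => (\1_(`[a, b]) z.1 * (D \_ `[c, d]) z.2) * K z.1 z.2).
  apply: measurable_funM; last exact: measurable_continuous_plane.
  apply: measurable_funM.
    by apply: measurableT_comp => //.
  apply: measurableT_comp => //.
  by apply/measurable_EFinP; case/integrableP : iD'.
have [M M0 KM] := continuous_rectangle_bounded a b c d cK.
apply/integrable12ltyP; first exact/measurable_EFinP.
pose Dn (y : R) := `|(D \_ `[c, d]) y|.
pose C := \int[leb]_y Dn y.
have iDn : leb.-integrable setT (EFin \o Dn) by exact: (integrable_norm iD').
have CE : (\int[leb]_y (Dn y)%:E = C%:E)%E.
  by rewrite /C /Rintegral fineK//; apply: integrable_fin_num.
have iMD : leb.-integrable setT (fun y => M%:E * (EFin \o Dn) y)%E.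
  exact: integrableZl.
apply: (@le_lt_trans _ _ (\int[leb]_x ((M * C) * \1_(`[a, b]) x)%:E)%E).
  apply: ge0_le_integral => //.
  - by move=> x _; apply: integral_ge0.
  - have mf' : measurable_fun setT (abse \o (fun z =>
      (\1_(`[a, b]) z.1 * (D \_ `[c, d]) z.2 * K z.1 z.2)%:E)).
      by apply: measurableT_comp => //; exact/measurable_EFinP.
    exact: (@measurable_fun_fubini_tonelli_F _ _ _ _ R leb _ mf'
      (fun z => abse_ge0 _)).
  - by apply/measurable_EFinP; apply: measurable_funM.
  - move=> x _ /=.
    have [xab|xab] := boolP (x \in `[a, b]%classic); last first.
      rewrite indicE (negbTE xab) mulr0.
      under eq_integral do rewrite !mul0r normr0.
      by rewrite integral0.
    rewrite indicE xab mulr1 EFinM -CE -ge0_integralZl//; last 2 first.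
    - exact: (measurable_int leb iDn).
    - by move=> y _; rewrite lee_fin normr_ge0.
    apply: ge0_le_integral => //.
    - apply/measurable_EFinP; apply: measurableT_comp => //.
      rewrite /=.
      apply: measurable_funM; first by apply: measurable_funM => //;
        apply/measurable_EFinP; case/integrableP : iD'.
      apply: continuous_measurable_fun.
      by apply: continuous_comp2 cK _ _ => y; [exact: cvg_cst|exact: cvg_id].
    - exact: (measurable_int leb iMD).
    - move=> y _; rewrite mul1r lee_fin normrM mulrC /Dn patchE.
      case: ifPn => [ycd|]; last by rewrite normr0 !mulr0.
      rewrite !inE in xab ycd.
      by rewrite ler_wpM2r ?normr_ge0// KM.
rewrite (_ : (fun x => _) = (fun x => ((M * C)%:E * (\1_(`[a, b]) x)%:E)%E)) //.
rewrite integralZl//; last exact: (integrable_indic_itv a b true false).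
rewrite integral_indic// setIT.
rewrite [X in (_ * X)%E](_ : _ = leb `[a, b]) // lebesgue_measure_itv/=.
by case: ifP => _; rewrite -?EFinB -?EFinM ?mule0 ltry.
Qed.

(** Continuity of [K] provides its measurability on the plane and a bound on
    the rectangle, so that the integrand is dominated by a multiple of [D]. *)
Lemma Rintegral_weighted_swap a b c d (D : R -> R) (K : R -> R -> R) :
  leb.-integrable `[c, d] (EFin \o D) ->
  continuous (fun z : R * R => K z.1 z.2) ->
  \int[leb]_(x in `[a, b]) \int[leb]_(y in `[c, d]) (D y * K x y) =
  \int[leb]_(y in `[c, d]) (D y * \int[leb]_(x in `[a, b]) K x y).
Proof.
move=> iD cK.
have cK1 x : continuous (K x).
  by apply: continuous_comp2 cK _ _ => y; [exact: cvg_cst|exact: cvg_id].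
have cK2 y : continuous (K ^~ y).
  by apply: continuous_comp2 cK _ _ => x; [exact: cvg_id|exact: cvg_cst].
have := Fubini (integrable_weighted_rectangle a b iD cK).
under eq_integral => x _.
  rewrite (_ : (fun y => _) = (fun y => (\1_(`[a, b]) x *
     ((fun y => D y * K x y) \_ `[c, d]) y)%:E)); last first.
    apply/funext => y /=; rewrite !patchE; case: ifP => _;
      last by rewrite !(mulr0, mul0r).
    by rewrite mulrA.
  rewrite integral_restrict_scale; last exact: integrable_weighted.
  over.
under [X in _ = X -> _]eq_integral => y _.
  rewrite (_ : (fun x => _) = (fun x => ((D \_ `[c, d]) y *
     ((K ^~ y) \_ `[a, b]) x)%:E)); last first.
    apply/funext => x /=; rewrite !patchE indicE; case: (x \in _);
      last by rewrite !(mulr0, mul0r).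
    by rewrite mul1r.
  rewrite integral_restrict_scale; last exact: integrable_continuous.
  over.
move=> /(congr1 (@fine R)) H.
rewrite Rintegral_mkcond [RHS]Rintegral_mkcond /Rintegral.
transitivity (fine (\int[leb]_x
    (\1_`[a, b] x * (\int[leb]_(y in `[c, d]) (D y * K x y))%R)%:E)%E).
  congr fine; apply: eq_integral => x _; rewrite patchE indicE.
  by case: ifP => _; rewrite ?mul1r ?mul0r.
rewrite H; congr fine; apply: eq_integral => y _; rewrite !patchE.
by case: ifP => _; rewrite ?mul0r.
Qed.

Lemma integrable1 a b : leb.-integrable `[a, b] (EFin \o (fun=> 1)).
Proof. by apply: integrable_continuous => y; exact: cvg_cst. Qed.

Lemma continuous_Rintegral (T : topologicalType) a b (K : T -> R -> R) :
  continuous (fun z : T * R => K z.1 z.2) ->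
  continuous (fun t => \int[leb]_(y in `[a, b]) K t y).
Proof.
move=> cK; rewrite (_ : (fun t => _) =
  (fun t => \int[leb]_(y in `[a, b]) (1 * K t y))).
  exact: (continuous_Rintegral_param (integrable1 a b) cK).
by apply/funext => t; apply: eq_Rintegral => y _; rewrite mul1r.
Qed.

Lemma Rintegral_swap a b c d (K : R -> R -> R) :
  continuous (fun z : R * R => K z.1 z.2) ->
  \int[leb]_(x in `[a, b]) \int[leb]_(y in `[c, d]) K x y =
  \int[leb]_(y in `[c, d]) \int[leb]_(x in `[a, b]) K x y.
Proof.
move=> cK; have := Rintegral_weighted_swap a b (integrable1 c d) cK.
under eq_Rintegral do under eq_Rintegral do rewrite mul1r.
by under [RHS]eq_Rintegral do rewrite mul1r.
Qed.

Lemma Rintegral_rectangle a b c d (K : R -> R -> R) :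
  continuous (fun z : R * R => K z.1 z.2) ->
  \int[(leb \x leb)%E]_(z in `[a, b] `*` `[c, d]) K z.1 z.2 =
  \int[leb]_(x in `[a, b]) \int[leb]_(y in `[c, d]) K x y.
Proof.
move=> cK.
have cK1 x : continuous (K x).
  by apply: continuous_comp2 cK _ _ => y; [exact: cvg_cst|exact: cvg_id].
have := integral12_prod_meas1
  (integrable_weighted_rectangle a b (integrable1 c d) cK).
under eq_integral => x _.
  rewrite /fubini_F (_ : (fun y => _) = (fun y => (\1_(`[a, b]) x *
     ((fun y => K x y) \_ `[c, d]) y)%:E)); last first.
    apply/funext => y /=; rewrite !patchE; case: ifP => _;
      last by rewrite !(mulr0, mul0r).
    by rewrite mulr1.
  rewrite integral_restrict_scale; last exact: integrable_continuous.
  over.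
move=> /(congr1 (@fine R)) H.
rewrite Rintegral_mkcond [RHS]Rintegral_mkcond /Rintegral.
transitivity (fine (\int[leb]_x
    (\1_`[a, b] x * (\int[leb]_(y in `[c, d]) K x y)%R)%:E)%E).
  rewrite H; congr fine; apply: eq_integral => -[x y] _ /=.
  rewrite !patchE indicE /=.
  rewrite in_setX /=.
  by case: (x \in _); case: (y \in _); rewrite /= ?(mul1r, mulr0, mul0r).
congr fine; apply: eq_integral => x _; rewrite !patchE indicE.
by case: ifP => _; rewrite ?mul1r ?mul0r.
Qed.

End continuous_fubini.

(** * Continuously differentiable functions of several variables *)

Section continuity_rules.
Context {R : realType} {T : topologicalType}.

Lemma continuous_idfun : continuous (fun t : T => t).
Proof. by move=> t; exact: cvg_id. Qed.

Lemma continuous_cst (U : topologicalType) (c : U) :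
  continuous (fun _ : T => c).
Proof. by move=> t; exact: cvg_cst. Qed.

Lemma continuous_fst_comp (U V : topologicalType) (f : T -> U * V) :
  continuous f -> continuous (fun t => (f t).1).
Proof. by move=> cf t; apply: cvg_comp (cf t) _; exact: cvg_fst. Qed.

Lemma continuous_snd_comp (U V : topologicalType) (f : T -> U * V) :
  continuous f -> continuous (fun t => (f t).2).
Proof. by move=> cf t; apply: cvg_comp (cf t) _; exact: cvg_snd. Qed.

Lemma continuous_real_comp (g : R -> R) (f : T -> R) :
  continuous g -> continuous f -> continuous (fun t => g (f t)).
Proof. by move=> cg cf t; apply: (continuous_comp (cf t)); exact: cg. Qed.

Implicit Types f g : T -> R.

Lemma continuous_addr f g :
  continuous f -> continuous g -> continuous (fun t => f t + g t).
Proof. by move=> cf cg t; apply: cvgD; [exact: cf|exact: cg]. Qed.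

Lemma continuous_oppr f : continuous f -> continuous (fun t => - f t).
Proof. by move=> cf t; apply: cvgN; exact: cf. Qed.

Lemma continuous_mulr f g :
  continuous f -> continuous g -> continuous (fun t => f t * g t).
Proof. by move=> cf cg t; apply: cvgM; [exact: cf|exact: cg]. Qed.

Lemma continuous_sin_comp f : continuous f -> continuous (fun t => sin (f t)).
Proof. by apply: continuous_real_comp; exact: continuous_sin. Qed.

Lemma continuous_cos_comp f : continuous f -> continuous (fun t => cos (f t)).
Proof. by apply: continuous_real_comp; exact: continuous_cos. Qed.

Lemma continuous_comp3 (A B C D : topologicalType) (K : A -> B -> C -> D)
    (f : T -> A) (g : T -> B) (h : T -> C) :
  continuous (fun z : A * B * C => K z.1.1 z.1.2 z.2) ->
  continuous f -> continuous g -> continuous h ->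
  continuous (fun t => K (f t) (g t) (h t)).
Proof.
move=> cK cf cg ch t.
apply: (@continuous_comp _ _ _ (fun t => (f t, g t, h t))
  (fun z => K z.1.1 z.1.2 z.2)); last exact: cK.
by apply: continuous_pair => //; apply: continuous_pair.
Qed.

Lemma continuous_comp4 (A B C D E : topologicalType)
    (K : A -> B -> C -> D -> E)
    (f : T -> A) (g : T -> B) (h : T -> C) (k : T -> D) :
  continuous (fun z : A * B * C * D => K z.1.1.1 z.1.1.2 z.1.2 z.2) ->
  continuous f -> continuous g -> continuous h -> continuous k ->
  continuous (fun t => K (f t) (g t) (h t) (k t)).
Proof.
move=> cK cf cg ch ck t.
apply: (@continuous_comp _ _ _ (fun t => (f t, g t, h t, k t))
  (fun z => K z.1.1.1 z.1.1.2 z.1.2 z.2)); last exact: cK.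
by do 3!(apply: continuous_pair => //).
Qed.

End continuity_rules.

(** Joint continuity is stated for functions of a nested pair; the tactic finds
    such hypotheses in the context and composes them with continuous arguments,
    by recursion on the body of the function. *)
Ltac continuity := cbv beta; lazymatch goal with
  | |- continuous (fun _ => ?c) => exact: continuous_cst
  | |- continuous (fun t => t) => exact: continuous_idfun
  | |- continuous fst => exact: (continuous_fst_comp continuous_idfun)
  | |- continuous snd => exact: (continuous_snd_comp continuous_idfun)
  | |- continuous sin => exact: continuous_sin
  | |- continuous cos => exact: continuous_cos
  | |- continuous (GRing.mul ?a) =>
      apply: (@continuous_mulr _ _ (fun=> a) (fun t => t)); continuity
  | |- continuous (GRing.add ?a) =>
      apply: (@continuous_addr _ _ (fun=> a) (fun t => t)); continuity
  | |- continuous GRing.opp =>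
      apply: (@continuous_oppr _ _ (fun t => t)); continuity
  | |- continuous (?K ?a ?b ?c) => match goal with
      H : continuous (fun z => K z.1.1.1 z.1.1.2 z.1.2 z.2) |- _ =>
        apply: (@continuous_comp4 _ _ _ _ _ _ K (fun=> a) (fun=> b) (fun=> c)
          (fun t => t) H); continuity end
  | |- continuous (?K ?a ?b) => match goal with
      H : continuous (fun z => K z.1.1 z.1.2 z.2) |- _ =>
        apply: (@continuous_comp3 _ _ _ _ _ K (fun=> a) (fun=> b)
          (fun t => t) H); continuity end
  | |- continuous (?K ?a) => match goal with
      H : continuous (fun z => K z.1 z.2) |- _ =>
        apply: (@continuous_comp2 _ _ _ _ K (fun=> a) (fun t => t) H);
        continuity end
  | |- continuous (fun t => (_).1) => apply: continuous_fst_comp; continuity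
  | |- continuous (fun t => (_).2) => apply: continuous_snd_comp; continuity
  | |- continuous (fun t => (_, _)) => apply: continuous_pair; continuity
  | |- continuous (fun t => _ + _) => apply: continuous_addr; continuity
  | |- continuous (fun t => _ * _) => apply: continuous_mulr; continuity
  | |- continuous (fun t => - _) => apply: continuous_oppr; continuity
  | |- continuous (fun t => sin _) => apply: continuous_sin_comp; continuity
  | |- continuous (fun t => cos _) => apply: continuous_cos_comp; continuity
  | |- continuous (fun t => Rintegral _ _ (fun y => @?K t y)) =>
      apply: (@continuous_Rintegral _ _ _ _ K); continuity
  | |- continuous (fun t => ?K _ _ _ _) => match goal with
      H : continuous (fun z => K z.1.1.1 z.1.1.2 z.1.2 z.2) |- _ =>
        apply: (continuous_comp4 H); continuity end
  | |- continuous (fun t => ?K _ _ _) => match goal with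
      H : continuous (fun z => K z.1.1 z.1.2 z.2) |- _ =>
        apply: (continuous_comp3 H); continuity end
  | |- continuous (fun t => ?K _ _) => match goal with
      H : continuous (fun z => K z.1 z.2) |- _ =>
        apply: (continuous_comp2 H); continuity end
  | |- continuous (fun t => ?K _) => match goal with
      H : continuous K |- _ => apply: (continuous_real_comp H); continuity end
  | _ => assumption
  end.

Section derivative_rules.
Context {R : realType}.
Implicit Types (f g F : R -> R) (t a b c : R).

Lemma is_derive_quotient f t a :
  is_derive t 1 f a <-> (fun h => h^-1 * (f (h + t) - f t)) @ 0^' --> a.
Proof.
have E : (fun h => h^-1 *: ((f \o shift t) (h *: 1) - f t)) =
    (fun h => h^-1 * (f (h + t) - f t)) :> (R -> R).
  by apply/funext => h; rewrite /= /GRing.scale/= mulr1.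
split=> [[df <-]|H].
  by move: df; rewrite /derivable /derive -E.
apply: DeriveDef; rewrite ?/derivable ?/derive E; first exact: cvgP H.
exact: cvg_lim H.
Qed.

Lemma is_derive_continuous f t a : is_derive t 1 f a -> {for t, continuous f}.
Proof. by move=> [/derivable1_diffP/differentiable_continuous]. Qed.

Lemma is_derive_cstr c t : is_derive t 1 (fun=> c) 0.
Proof. exact: is_derive_cst. Qed.

Lemma is_derive_idr t : is_derive t 1 (fun s => s) 1.
Proof. exact: is_derive_id. Qed.

Lemma is_derive_addr f g t a b : is_derive t 1 f a -> is_derive t 1 g b ->
  is_derive t 1 (fun s => f s + g s) (a + b).
Proof. by move=> df dg; exact: is_deriveD. Qed.

Lemma is_derive_oppr f t a : is_derive t 1 f a ->
  is_derive t 1 (fun s => - f s) (- a).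
Proof. by move=> df; exact: is_deriveN. Qed.

Lemma is_derive_mulr f g t a b : is_derive t 1 f a -> is_derive t 1 g b ->
  is_derive t 1 (fun s => f s * g s) (a * g t + f t * b).
Proof.
move=> df dg; apply: (is_derive_eq (is_deriveM df dg)).
by rewrite /GRing.scale/= addrC (mulrC (g t)).
Qed.

Local Notation leb := (@lebesgue_measure R).

Lemma Rintegral_derivative F f a b : a <= b -> continuous f ->
  (forall x : R, is_derive x 1 F (f x)) ->
  \int[leb]_(x in `[a, b]) f x = F b - F a.
Proof.
rewrite le_eqVlt => /predU1P[->|ab] cf dF.
  by rewrite set_itv1 Rintegral_set1 subrr.
rewrite /Rintegral (@continuous_FTC2 _ f F)//.
- exact: continuous_subspaceT.
- split => [x _| |]; first by case: (dF x).
  + by apply: cvg_at_right_filter; exact: is_derive_continuous (dF a).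
  + by apply: cvg_at_left_filter; exact: is_derive_continuous (dF b).
- by move=> x _; rewrite derive1E; case: (dF x).
Qed.

End derivative_rules.

Section C1_functions_of_space.
Context {R : realType}.
Local Notation leb := (@lebesgue_measure R).

(** Continuous differentiability in the form of the chain rule along curves,
    which is how it enters the differentiation along orbits of rotations. *)
Definition C1_space (g : R -> R -> R -> R) :=
  exists g1 g2 g3 : R -> R -> R -> R,
  [/\ continuous (fun v : R * R * R => g v.1.1 v.1.2 v.2),
      continuous (fun v : R * R * R => g1 v.1.1 v.1.2 v.2),
      continuous (fun v : R * R * R => g2 v.1.1 v.1.2 v.2),
      continuous (fun v : R * R * R => g3 v.1.1 v.1.2 v.2) &
      forall (x y z : R -> R) (t dx dy dz : R),
        is_derive t 1 x dx -> is_derive t 1 y dy -> is_derive t 1 z dz ->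
        is_derive t 1 (fun s => g (x s) (y s) (z s))
          (g1 (x t) (y t) (z t) * dx + g2 (x t) (y t) (z t) * dy
           + g3 (x t) (y t) (z t) * dz)].

(** Hadamard's lemma in one variable: the mean of the derivative over a segment
    is, unlike a value given by the mean value theorem, continuous in its end
    points. *)
Lemma increment_mean_derivative (g dg : R -> R) (x x' : R) :
  continuous dg -> (forall s : R, is_derive s 1 g (dg s)) ->
  g x' - g x = (x' - x) * \int[leb]_(u in `[0, 1]) dg (x + u * (x' - x)).
Proof.
move=> cdg gdg.
have cu : continuous (fun u : R => dg (x + u * (x' - x))) by continuity.
rewrite -RintegralZl//; last exact: integrable_continuous.
have D (u : R) : is_derive u 1 (fun u => g (x + u * (x' - x)))
    ((x' - x) * dg (x + u * (x' - x))).
  rewrite mulrC; apply: (is_derive1_comp (gdg _)).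
  have H := is_derive_addr (is_derive_cstr x u)
    (is_derive_mulr (is_derive_idr u) (is_derive_cstr (x' - x) u)).
  by apply: is_derive_eq H _; rewrite add0r mul1r mulr0 addr0.
have c' : continuous (fun u : R => (x' - x) * dg (x + u * (x' - x))).
  by continuity.
rewrite (Rintegral_derivative ler01 c' D).
by rewrite mul1r mul0r addr0 [x + _]addrC subrK.
Qed.

(** Existence of continuous partial derivatives implies the chain rule: the
    increment is a sum of three increments along the axes, each of which is the
    displacement times a factor depending continuously on the end point. *)
Lemma C1_space_partials (g g1 g2 g3 : R -> R -> R -> R) :
  continuous (fun v : R * R * R => g v.1.1 v.1.2 v.2) ->
  continuous (fun v : R * R * R => g1 v.1.1 v.1.2 v.2) ->
  continuous (fun v : R * R * R => g2 v.1.1 v.1.2 v.2) ->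
  continuous (fun v : R * R * R => g3 v.1.1 v.1.2 v.2) ->
  (forall x y z : R, is_derive x 1 (fun s => g s y z) (g1 x y z)) ->
  (forall x y z : R, is_derive y 1 (fun s => g x s z) (g2 x y z)) ->
  (forall x y z : R, is_derive z 1 (fun s => g x y s) (g3 x y z)) ->
  C1_space g.
Proof.
move=> cg c1 c2 c3 d1 d2 d3; exists g1, g2, g3; split => // x y z t dx dy dz.
move=> Dx Dy Dz; apply/is_derive_quotient.
pose M1 (a b c : R) := \int[leb]_(u in `[0, 1]) g1 (x t + u * (a - x t)) b c.
pose M2 (b c : R) := \int[leb]_(u in `[0, 1]) g2 (x t) (y t + u * (b - y t)) c.
pose M3 (c : R) := \int[leb]_(u in `[0, 1]) g3 (x t) (y t) (z t + u * (c - z t)).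
have cM1 : continuous (fun v : R * R * R => M1 v.1.1 v.1.2 v.2).
  by rewrite /M1; continuity.
have cM2 : continuous (fun v : R * R => M2 v.1 v.2) by rewrite /M2; continuity.
have cM3 : continuous M3 by rewrite /M3; continuity.
have incr a b c : g a b c - g (x t) (y t) (z t) =
    (a - x t) * M1 a b c + (b - y t) * M2 b c + (c - z t) * M3 c.
  rewrite /M1 /M2 /M3.
  have k1 : continuous (fun s => g1 s b c) by continuity.
  have k2 : continuous (fun s => g2 (x t) s c) by continuity.
  have k3 : continuous (fun s => g3 (x t) (y t) s) by continuity.
  rewrite -(increment_mean_derivative (x t) a k1 (fun s => d1 s b c)).
  rewrite -(increment_mean_derivative (y t) b k2 (fun s => d2 (x t) s c)).
  rewrite -(increment_mean_derivative (z t) c k3 (fun s => d3 (x t) (y t) s)).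
  by rewrite /=; ring.
have -> : (fun h => h^-1 * (g (x (h + t)) (y (h + t)) (z (h + t))
      - g (x t) (y t) (z t))) =
    (fun h => M1 (x (h + t)) (y (h + t)) (z (h + t)) * (h^-1 * (x (h + t) - x t))
      + M2 (y (h + t)) (z (h + t)) * (h^-1 * (y (h + t) - y t))
      + M3 (z (h + t)) * (h^-1 * (z (h + t) - z t))).
  by apply/funext => h; rewrite incr; ring.
have atE (f : R -> R) a : is_derive t 1 f a -> f (h + t) @[h --> 0^'] --> f t.
  move=> /is_derive_continuous cf; apply: cvg_trans; last exact: cf.
  move=> U /= [e e0 eU]; exists e => //= h; rewrite /= sub0r normrN => he _.
  by apply: eU; rewrite /= opprD addrC addrNK normrN.
have mean1 (K : R -> R) (c : R) : (forall u, K u = c) ->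
    \int[leb]_(u in `[0, 1]) K u = c.
  move=> Kc; rewrite (_ : K = cst c); last by apply/funext.
  rewrite Rintegral_cst//= lebesgue_measure_itv/= lte_fin ltr01.
  by rewrite -EFinB/= subr0 mulr1.
apply: cvgD; first apply: cvgD.
- apply: cvgM; last exact/is_derive_quotient.
  have <- : M1 (x t) (y t) (z t) = g1 (x t) (y t) (z t).
    by apply: mean1 => u; rewrite subrr mulr0 addr0.
  have H : (x (h + t), y (h + t), z (h + t)) @[h --> 0^']
      --> (x t, y t, z t).
    exact: (cvg_pair (cvg_pair (atE x dx Dx) (atE y dy Dy)) (atE z dz Dz)).
  exact: (cvg_comp _ _ H (cM1 (x t, y t, z t))).
- apply: cvgM; last exact/is_derive_quotient.
  have <- : M2 (y t) (z t) = g2 (x t) (y t) (z t).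
    by apply: mean1 => u; rewrite subrr mulr0 addr0.
  have H : (y (h + t), z (h + t)) @[h --> 0^'] --> (y t, z t).
    exact: (cvg_pair (atE y dy Dy) (atE z dz Dz)).
  exact: (cvg_comp _ _ H (cM2 (y t, z t))).
- apply: cvgM; last exact/is_derive_quotient.
  have <- : M3 (z t) = g3 (x t) (y t) (z t).
    by apply: mean1 => u; rewrite subrr mulr0 addr0.
  exact: (cvg_comp _ _ (atE z dz Dz) (cM3 (z t))).
Qed.

End C1_functions_of_space.

Section smooth_functions.
Context {R : realType}.

Definition vec3 (x y z : R) : 'cV[R]_3 := \col_(i < 3) [:: x; y; z]`_i.

Lemma continuous_vec3 : continuous (fun v : R * R * R => vec3 v.1.1 v.1.2 v.2).
Proof.
move=> v U /= /nbhs_ballP[e /= e0 eU]; apply/nbhs_ballP; exists e => //= w.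
move=> [[vw1 vw2] vw3]; apply: eU; split=> // -[i i3] j; rewrite !mxE.
by case: i i3 => [|[|[|]]].
Qed.

Lemma smooth_C1_space (f : 'cV[R]_3 -> R) :
  smooth f -> C1_space (fun x y z => f (vec3 x y z)).
Proof.
move=> smf; have [cf df] := smf [::].
have cont (g : 'cV[R]_3 -> R) : continuous g ->
    continuous (fun v : R * R * R => g (vec3 v.1.1 v.1.2 v.2)).
  move=> cg v; apply: (@continuous_comp _ _ _
    (fun v : R * R * R => vec3 v.1.1 v.1.2 v.2) g); last exact: cg.
  exact: continuous_vec3.
have cD i : continuous ('D_(delta_mx i 0) f : 'cV[R]_3 -> R).
  exact: (smf [:: i]).1.
have partial (i : 'I_3) (v : 'cV[R]_3) (k : R -> 'cV[R]_3) (t : R) : k t = v ->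
    (forall h, k (h + t) = h *: delta_mx i 0 + v) ->
    is_derive t 1 (fun s => f (k s)) ('D_(delta_mx i 0) f v).
  move=> ktv kv; apply/is_derive_quotient; rewrite ktv.
  under eq_fun do rewrite kv.
  exact: (df i v).
pose d i x y z := 'D_(delta_mx i 0) f (vec3 x y z).
apply: (@C1_space_partials _ _ (d 0) (d 1) (d 2) (cont f cf) (cont _ (cD 0))
  (cont _ (cD 1)) (cont _ (cD 2))) => x y z.
- apply: (partial 0 _ (fun s => vec3 s y z)) => // h; apply/matrixP => i j.
  rewrite !mxE (ord1 j) eqxx andbT.
  by case: i => [[|[|[|]]]]//= ?; rewrite ?mulr1 ?mulr0 ?add0r.
- apply: (partial 1 _ (fun s => vec3 x s z)) => // h; apply/matrixP => i j.
  rewrite !mxE (ord1 j) eqxx andbT.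
  by case: i => [[|[|[|]]]]//= ?; rewrite ?mulr1 ?mulr0 ?add0r.
- apply: (partial 2 _ (fun s => vec3 x y s)) => // h; apply/matrixP => i j.
  rewrite !mxE (ord1 j) eqxx andbT.
  by case: i => [[|[|[|]]]]//= ?; rewrite ?mulr1 ?mulr0 ?add0r.
Qed.

End smooth_functions.

(** * Invariance of the integral over rotations in Euler angles *)

Section triple_integral.
Context {R : realType}.
Local Notation leb := (@lebesgue_measure R).

Definition integral3 (G : R -> R -> R -> R) : R :=
  \int[leb]_(a in `[0, 2 * pi]) \int[leb]_(b in `[0, pi])
    \int[leb]_(h in `[0, 2 * pi]) G a b h.

Lemma eq_integral3 (G H : R -> R -> R -> R) :
  (forall a b h, a \in `[0, 2 * pi] -> b \in `[0, pi] -> h \in `[0, 2 * pi] ->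
    G a b h = H a b h) ->
  integral3 G = integral3 H.
Proof.
move=> GH; apply: eq_Rintegral => a ax; apply: eq_Rintegral => b bx.
by apply: eq_Rintegral => h hx; apply: GH; exact: set_mem.
Qed.

Lemma RintegralB_continuous (a b : R) (g k : R -> R) :
  continuous g -> continuous k ->
  \int[leb]_(x in `[a, b]) (g x - k x) =
  \int[leb]_(x in `[a, b]) g x - \int[leb]_(x in `[a, b]) k x.
Proof. by move=> cg ck; apply: RintegralB => //; exact: integrable_continuous. Qed.

Lemma integral3B (G H : R -> R -> R -> R) :
  continuous (fun v : R * R * R => G v.1.1 v.1.2 v.2) ->
  continuous (fun v : R * R * R => H v.1.1 v.1.2 v.2) ->
  integral3 (fun a b h => G a b h - H a b h) = integral3 G - integral3 H.
Proof.
move=> cG cH; rewrite /integral3 -RintegralB_continuous; [|by continuity..].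
apply: eq_Rintegral => a _; rewrite -RintegralB_continuous; [|by continuity..].
by apply: eq_Rintegral => b _; rewrite -RintegralB_continuous//; continuity.
Qed.

Lemma integral3_swap (c d : R) (G : R -> R -> R -> R -> R) :
  continuous (fun v : R * R * R * R => G v.1.1.1 v.1.1.2 v.1.2 v.2) ->
  integral3 (fun a b h => \int[leb]_(s in `[c, d]) G a b h s) =
  \int[leb]_(s in `[c, d]) integral3 (fun a b h => G a b h s).
Proof.
move=> cG; rewrite /integral3 [RHS]Rintegral_swap; last by continuity.
apply: eq_Rintegral => a _; rewrite [RHS]Rintegral_swap; last by continuity.
by apply: eq_Rintegral => b _; rewrite [RHS]Rintegral_swap//; continuity.
Qed.

End triple_integral.

Section divergence.
Context {R : realType}.
Local Notation leb := (@lebesgue_measure R).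

Lemma Rintegral_pair0 (a b c d : R) (G : R -> R -> R) :
  (forall x, \int[leb]_(y in `[c, d]) G x y = 0) ->
  \int[leb]_(x in `[a, b]) \int[leb]_(y in `[c, d]) G x y = 0.
Proof.
move=> G0; under eq_Rintegral do rewrite G0.
by rewrite Rintegral_cst// mul0r.
Qed.

Variables F Fa Fb Fh : R -> R -> R -> R.
Hypothesis cF : continuous (fun v : R * R * R => F v.1.1 v.1.2 v.2).
Hypothesis cFa : continuous (fun v : R * R * R => Fa v.1.1 v.1.2 v.2).
Hypothesis cFb : continuous (fun v : R * R * R => Fb v.1.1 v.1.2 v.2).
Hypothesis cFh : continuous (fun v : R * R * R => Fh v.1.1 v.1.2 v.2).
Hypothesis dFa : forall a b h : R, is_derive a 1 (fun s => F s b h) (Fa a b h).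
Hypothesis dFb : forall a b h : R, is_derive b 1 (fun s => F a s h) (Fb a b h).
Hypothesis dFh : forall a b h : R, is_derive h 1 (fun s => F a b s) (Fh a b h).
Hypothesis F2pi : forall b h, F (2 * pi) b h = F 0 b h.

(** The integrand is the divergence of
    (sin h F, sin b cos h F, - cos b sin h F), whose flux through the boundary
    of the box vanishes: sin b = 0 for b = 0, pi, sin h = 0 for h = 0, 2 pi,
    and F is periodic in the first angle. *)
Lemma integral3_divergence :
  integral3 (fun a b h => sin b * cos h * Fb a b h + sin h * Fa a b h
    - cos b * sin h * Fh a b h) = 0.
Proof.
have pi20 : 0 <= 2 * pi :> R by rewrite mulr_ge0// pi_ge0.
rewrite (@eq_integral3 _ _ (fun a b h =>
    (cos b * cos h * F a b h + sin b * cos h * Fb a b h)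
    - (cos b * cos h * F a b h + cos b * sin h * Fh a b h)
    - (- sin h) * Fa a b h)); last by move=> *; ring.
rewrite integral3B; [|by continuity..].
rewrite integral3B; [|by continuity..].
have -> : integral3 (fun a b h =>
    cos b * cos h * F a b h + sin b * cos h * Fb a b h) = 0.
  apply: Rintegral_pair0 => a; rewrite Rintegral_swap; last by continuity.
  apply: Rintegral_pair0 => h.
  have D (b : R) : is_derive b 1 (fun s => sin s * cos h * F a s h)
      (cos b * cos h * F a b h + sin b * cos h * Fb a b h).
    apply: is_derive_eq (is_derive_mulr (is_derive_mulr (is_derive_sin b)
      (is_derive_cstr (cos h) b)) (dFb a b h)) _.
    by ring.
  rewrite (Rintegral_derivative (pi_ge0 R) _ D); last by continuity.
  by rewrite sinpi sin0 !mul0r subrr.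
have -> : integral3 (fun a b h =>
    cos b * cos h * F a b h + cos b * sin h * Fh a b h) = 0.
  apply: Rintegral_pair0 => a; apply: Rintegral_pair0 => b.
  have D (h : R) : is_derive h 1 (fun s => cos b * sin s * F a b s)
      (cos b * cos h * F a b h + cos b * sin h * Fh a b h).
    apply: is_derive_eq (is_derive_mulr (is_derive_mulr
      (is_derive_cstr (cos b) h) (is_derive_sin h)) (dFh a b h)) _.
    by ring.
  rewrite (Rintegral_derivative pi20 _ D); last by continuity.
  by rewrite mulr_natl sin2pi sin0 !mulr0 !mul0r subrr.
have -> : integral3 (fun a b h => - sin h * Fa a b h) = 0.
  rewrite /integral3 Rintegral_swap; last by continuity.
  apply: Rintegral_pair0 => b; rewrite Rintegral_swap; last by continuity.
  apply: Rintegral_pair0 => h.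
  have D (a : R) : is_derive a 1 (fun s => - sin h * F s b h)
      (- sin h * Fa a b h).
    apply: is_derive_eq (is_derive_mulr (is_derive_cstr (- sin h) a)
      (dFa a b h)) _.
    by ring.
  rewrite (Rintegral_derivative pi20 _ D); last by continuity.
  by rewrite F2pi subrr.
by rewrite !subrr.
Qed.

End divergence.

Section orbit.
Context {R : realType}.
Local Notation leb := (@lebesgue_measure R).

(** The coordinates of [rotU a *m rotV b *m rotU h *m rotV s] applied to the
    north pole. *)
Definition orbit_x (a b h s : R) : R :=
  cos a * (cos b * (sin s * cos h) + sin b * cos s) - sin a * (sin s * sin h).
Definition orbit_y (a b h s : R) : R :=
  sin a * (cos b * (sin s * cos h) + sin b * cos s) + cos a * (sin s * sin h).
Definition orbit_z (a b h s : R) : R :=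
  cos b * cos s - sin b * (sin s * cos h).

Definition on_orbit (g : R -> R -> R -> R) (a b h s : R) : R :=
  g (orbit_x a b h s) (orbit_y a b h s) (orbit_z a b h s).

Lemma continuous_on_orbit (g : R -> R -> R -> R) :
  continuous (fun v : R * R * R => g v.1.1 v.1.2 v.2) ->
  continuous (fun v : R * R * R * R => on_orbit g v.1.1.1 v.1.1.2 v.1.2 v.2).
Proof.
by move=> cg; rewrite /on_orbit /orbit_x /orbit_y /orbit_z; continuity.
Qed.

(** Right multiplication by [rotV s] moves a rotation along a left-invariant
    vector field, expressed here by the derivatives in the Euler angles. *)
Lemma on_orbit_derivatives (g : R -> R -> R -> R) : C1_space g ->
  exists Ga Gb Gh Gs : R -> R -> R -> R -> R,
  [/\ continuous (fun v : R * R * R * R => Ga v.1.1.1 v.1.1.2 v.1.2 v.2)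
      /\ continuous (fun v : R * R * R * R => Gb v.1.1.1 v.1.1.2 v.1.2 v.2),
      continuous (fun v : R * R * R * R => Gh v.1.1.1 v.1.1.2 v.1.2 v.2)
      /\ continuous (fun v : R * R * R * R => Gs v.1.1.1 v.1.1.2 v.1.2 v.2),
      (forall a b h s : R,
         is_derive a 1 (fun u => on_orbit g u b h s) (Ga a b h s))
      /\ (forall a b h s : R,
         is_derive b 1 (fun u => on_orbit g a u h s) (Gb a b h s)),
      (forall a b h s : R,
         is_derive h 1 (fun u => on_orbit g a b u s) (Gh a b h s))
      /\ (forall a b h s : R,
         is_derive s 1 (fun u => on_orbit g a b h u) (Gs a b h s)) &
      forall a b h s, sin b * Gs a b h s = sin b * cos h * Gb a b h s
        + sin h * Ga a b h s - cos b * sin h * Gh a b h s].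
Proof.
move=> [g1 [g2 [g3 [cg c1 c2 c3 dg]]]].
pose grad (dx dy dz : R -> R -> R -> R -> R) (a b h s : R) :=
  on_orbit g1 a b h s * dx a b h s + on_orbit g2 a b h s * dy a b h s
  + on_orbit g3 a b h s * dz a b h s.
pose X (a b h s : R) := cos b * (sin s * cos h) + sin b * cos s.
pose xa a b h s : R := - orbit_y a b h s.
pose ya a b h s : R := orbit_x a b h s.
pose za (a b h s : R) : R := 0.
pose xb a b h s : R := cos a * orbit_z a b h s.
pose yb a b h s : R := sin a * orbit_z a b h s.
pose zb a b h s : R := - X a b h s.
pose xh (a b h s : R) : R :=
  - cos a * (cos b * (sin s * sin h)) - sin a * (sin s * cos h).
pose yh (a b h s : R) : R :=
  - sin a * (cos b * (sin s * sin h)) + cos a * (sin s * cos h).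
pose zh (a b h s : R) : R := sin b * (sin s * sin h).
pose xs (a b h s : R) : R :=
  cos a * (cos b * (cos s * cos h) - sin b * sin s) - sin a * (cos s * sin h).
pose ys (a b h s : R) : R :=
  sin a * (cos b * (cos s * cos h) - sin b * sin s) + cos a * (cos s * sin h).
pose zs (a b h s : R) : R := - cos b * sin s - sin b * (cos s * cos h).
have cos_ g' : continuous (fun v : R * R * R => g' v.1.1 v.1.2 v.2) ->
  continuous (fun v : R * R * R * R => on_orbit g' v.1.1.1 v.1.1.2 v.1.2 v.2).
  exact: continuous_on_orbit.
have o1 := cos_ _ c1; have o2 := cos_ _ c2; have o3 := cos_ _ c3.
exists (grad xa ya za), (grad xb yb zb), (grad xh yh zh), (grad xs ys zs).
split.
- by split; rewrite /grad /xa /ya /za /xb /yb /zb /X /orbit_x /orbit_y /orbit_z;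
    continuity.
- by split; rewrite /grad /xh /yh /zh /xs /ys /zs; continuity.
- split=> a b h s; apply: dg;
   rewrite /xa /ya /za /xb /yb /zb /X /orbit_x /orbit_y /orbit_z;
   (apply: is_derive_eq; rewrite /GRing.scale/=; ring).
- split=> a b h s; apply: dg;
   rewrite /xh /yh /zh /xs /ys /zs /orbit_x /orbit_y /orbit_z;
   (apply: is_derive_eq; rewrite /GRing.scale/=; ring).
- move=> a b h s; rewrite /grad /xa /ya /za /xb /yb /zb /xh /yh /zh /xs /ys /zs.
  rewrite /X /orbit_x /orbit_y /orbit_z.
  have ch : cos h ^+ 2 = 1 - sin h ^+ 2 by rewrite -(cos2Dsin2 h) addrK.
  have cb : cos b ^+ 2 = 1 - sin b ^+ 2 by rewrite -(cos2Dsin2 b) addrK.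
  by ring: ch cb.
Qed.

(** Averaging over the circle of points at angular distance [s] is a symmetric
    operator on functions on the sphere. The rotation-invariant integral of
    [on_orbit g a b h (s - t) * on_orbit k a b h (- t)] does not depend on [t];
    it is compared at [t = 0] and [t = s]. *)
Lemma circle_mean_symmetric (g k : R -> R -> R -> R) (s : R) :
  C1_space g -> C1_space k -> 0 <= s ->
  integral3 (fun a b h => sin b * (on_orbit g a b h s * on_orbit k a b h 0)) =
  integral3 (fun a b h => sin b * (on_orbit g a b h 0 * on_orbit k a b h (- s))).
Proof.
move=> C1g C1k s0.
have cg : continuous (fun v : R * R * R * R => on_orbit g v.1.1.1 v.1.1.2 v.1.2 v.2).
  by apply: continuous_on_orbit; case: C1g => ? [? [? []]].
have ck : continuous (fun v : R * R * R * R => on_orbit k v.1.1.1 v.1.1.2 v.1.2 v.2).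
  by apply: continuous_on_orbit; case: C1k => ? [? [? []]].
have [Ga [Gb [Gh [Gs [[cGa cGb] [cGh cGs] [dGa dGb] [dGh dGs] Grel]]]]] :=
  on_orbit_derivatives C1g.
have [Ka [Kb [Kh [Ks [[cKa cKb] [cKh cKs] [dKa dKb] [dKh dKs] Krel]]]]] :=
  on_orbit_derivatives C1k.
pose F a b h t := on_orbit g a b h (s - t) * on_orbit k a b h (- t).
pose F' (G' K' : R -> R -> R -> R -> R) a b h t :=
  G' a b h (s - t) * on_orbit k a b h (- t)
  + on_orbit g a b h (s - t) * K' a b h (- t).
have cF : continuous (fun v : R * R * R * R => F v.1.1.1 v.1.1.2 v.1.2 v.2).
  by rewrite /F; continuity.
have cFs : continuous (fun v : R * R * R * R =>
    F' Gs Ks v.1.1.1 v.1.1.2 v.1.2 v.2) by rewrite /F'; continuity.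
suff : integral3 (fun a b h => sin b * F a b h s)
    - integral3 (fun a b h => sin b * F a b h 0) = 0.
  move=> /subr0_eq; rewrite /F subrr subr0 oppr0 => ->.
  by apply: eq_integral3.
rewrite -integral3B; [|by continuity..].
(* The increment from t = 0 to t = s is the integral of the derivative. *)
rewrite (@eq_integral3 _ _ (fun a b h =>
  \int[leb]_(t in `[0, s]) (sin b * - F' Gs Ks a b h t))); last first.
  move=> a b h _ _ _.
  have D (t : R) : is_derive t 1 (fun u => sin b * F a b h u)
      (sin b * - F' Gs Ks a b h t).
    have dgs : is_derive t 1 (fun u => on_orbit g a b h (s - u))
        (Gs a b h (s - t) * (0 + - 1)).
      have D1 : is_derive t 1 (fun u => s - u) (0 + - 1) :=
        is_derive_addr (is_derive_cstr s t) (is_derive_oppr (is_derive_idr t)).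
      exact: (@is_derive1_comp _ _ (fun u => s - u) t _ _
        (dGs a b h (s - t)) D1).
    have dks : is_derive t 1 (fun u => on_orbit k a b h (- u))
        (Ks a b h (- t) * - 1).
      have D1 : is_derive t 1 (fun u : R => - u) (- 1) :=
        is_derive_oppr (is_derive_idr t).
      exact: (@is_derive1_comp _ _ (fun u => - u) t _ _ (dKs a b h (- t)) D1).
    apply: is_derive_eq (is_derive_mulr (is_derive_cstr (sin b) t)
      (is_derive_mulr dgs dks)) _.
    by rewrite /F'; ring.
  by rewrite (Rintegral_derivative s0 _ D)//; continuity.
rewrite integral3_swap; last by continuity.
rewrite -[RHS](mul0r (fine (leb `[0, s]%classic))) -Rintegral_cst//.
apply: eq_Rintegral => t _.
(* At a fixed t both factors satisfy the same linear relation between their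
   derivatives, hence so does the product. *)
rewrite (@eq_integral3 _ _ (fun a b h => 0
    - (sin b * cos h * F' Gb Kb a b h t + sin h * F' Ga Ka a b h t
       - cos b * sin h * F' Gh Kh a b h t))); last first.
  move=> a b h _ _ _; rewrite sub0r mulrN; congr (- _).
  rewrite /F' mulrDr.
  have -> : sin b * (Gs a b h (s - t) * on_orbit k a b h (- t)) =
    (sin b * Gs a b h (s - t)) * on_orbit k a b h (- t) by rewrite mulrA.
  have -> : sin b * (on_orbit g a b h (s - t) * Ks a b h (- t)) =
    (sin b * Ks a b h (- t)) * on_orbit g a b h (s - t) by rewrite mulrCA mulrC.
  by rewrite Grel Krel; ring.
rewrite (@integral3B _ (fun _ _ _ => 0)); [|by rewrite /F'; continuity..].
rewrite (_ : integral3 (fun _ _ _ => 0) = 0); last first.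
  by apply: Rintegral_pair0 => a; apply: Rintegral_pair0 => b;
    rewrite Rintegral_cst// mul0r.
rewrite (@integral3_divergence _ (fun a b h => F a b h t)
  (fun a b h => F' Ga Ka a b h t) (fun a b h => F' Gb Kb a b h t)
  (fun a b h => F' Gh Kh a b h t) _ _ _ _
  (fun a b h => is_derive_mulr (dGa a b h (s - t)) (dKa a b h (- t)))
  (fun a b h => is_derive_mulr (dGb a b h (s - t)) (dKb a b h (- t)))
  (fun a b h => is_derive_mulr (dGh a b h (s - t)) (dKh a b h (- t)))).
- by rewrite subr0.
- by rewrite /F; continuity.
- by rewrite /F'; continuity.
- by rewrite /F'; continuity.
- by rewrite /F'; continuity.
- move=> b h; rewrite /F /on_orbit /orbit_x /orbit_y mulr_natl.
  by rewrite sin2pi cos2pi sin0 cos0.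
Qed.

End orbit.
(** * Legendre polynomials as coefficients of powers of trinomials *)

Section trinomials.
Variable A : comNzRingType.

Definition trinomial (a b d : A) : {poly A} := a%:P + b *: 'X + d *: 'X^2.

(** The Taylor formula: it turns derivatives of Legendre polynomials into
    coefficients of powers of a trinomial. *)
Lemma coef_comp_shift (p : {poly A}) c k :
  (p \Po ('X + c%:P))`_k = (p^`N(k)).[c].
Proof.
elim/poly_ind: p k => [|p a IH] [|k].
- by rewrite comp_poly0 coef0 nderivn0 horner0.
- by rewrite comp_poly0 coef0 raddf0 horner0.
- rewrite comp_poly_MXaddC mulrDr !coefD coefMX coefMC coefC/= add0r IH.
  by rewrite !nderivn0 hornerMXaddC.
- rewrite comp_poly_MXaddC mulrDr !coefD coefMX coefMC coefC/= addr0 !IH.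
  by rewrite nderivnMXaddC hornerD hornerMX.
Qed.

Lemma coef_exp_XaddC (c : A) n i : (('X + c%:P) ^+ n)`_i = c ^+ (n - i) *+ 'C(n, i).
Proof.
have -> : ('X + c%:P) ^+ n = 'X^n \Po ('X + c%:P).
  by rewrite rmorphXn /= comp_polyX.
by rewrite coef_comp_shift nderivnXn hornerMn hornerXn.
Qed.

(** The substitution of [k *: 'X] for ['X]. *)
Lemma coef_trinomial_exp_scale (a b d k : A) n i :
  (trinomial a (b * k) (d * k ^+ 2) ^+ n)`_i = k ^+ i * (trinomial a b d ^+ n)`_i.
Proof.
have -> : trinomial a (b * k) (d * k ^+ 2) = trinomial a b d \Po (k *: 'X).
  rewrite /trinomial !comp_polyD comp_polyC !comp_polyZ rmorphXn /= comp_polyX.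
  by rewrite exprZn !scalerA.
rewrite -rmorphXn /= comp_polyE coef_sum.
under eq_bigr do rewrite exprZn !coefZ coefXn.
have [ip|pi] := ltnP i (size (trinomial a b d ^+ n)).
  rewrite (bigD1 (Ordinal ip))//= eqxx mulr1 big1 ?addr0 1?mulrC//.
  by move=> j jp; rewrite eq_sym (negbTE (_ : nat_of_ord j != i)) ?mulr0.
rewrite nth_default// mulr0 big1// => j _.
rewrite (negbTE (_ : i != j)) ?mulr0//.
by rewrite neq_ltn (leq_trans (ltn_ord j) pi) orbT.
Qed.

End trinomials.

Section rodrigues.
Variable A : comNzRingType.

(** The Rodrigues formula: the Taylor expansion of (X^2 - 1)^l around a point
    is the product of those of (X - 1)^l and (X + 1)^l. *)
Lemma nderivn_exp_X2sub1 l : (('X^2 - 1 : {poly A}) ^+ l)^`N(l) =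
  \sum_(k < l.+1) ('C(l, k) ^ 2)%:R *: (('X - 1) ^+ (l - k) * ('X + 1) ^+ k).
Proof.
(* Over the ring of polynomials the Taylor expansion is taken around 'X. *)
rewrite -[LHS]comp_polyXr; pose p : {poly A} := ('X^2 - 1) ^+ l.
have -> : p^`N(l) \Po 'X = ((map_poly polyC p)^`N(l)).['X].
  by rewrite nderivn_map.
rewrite -(coef_comp_shift (map_poly polyC p) 'X l).
have -> : map_poly polyC p \Po ('X + 'X%:P) =
    ('X + ('X - 1)%:P) ^+ l * ('X + ('X + 1)%:P) ^+ l.
  rewrite rmorphXn rmorphXn /= -exprMn; congr (_ ^+ _).
  rewrite rmorphB rmorphXn /= map_polyX rmorph1 comp_polyB rmorphXn /=.
  by rewrite comp_polyX rmorph1 polyCB polyCD polyC1; ring.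
rewrite coefM; apply: eq_bigr => k _.
rewrite !coef_exp_XaddC (subKn (ltnSE (ltn_ord k))) bin_sub ?(ltnSE (ltn_ord k))//.
by rewrite mulrnAl mulrnAr -mulrnA -scaler_nat mulnn.
Qed.

Lemma X2sub1_comp_shift (c : A) :
  ('X^2 - 1) \Po ('X + c%:P) = trinomial (c ^+ 2 - 1) (2 * c) 1.
Proof.
rewrite comp_polyB rmorphXn /= comp_polyX rmorph1 /trinomial scale1r.
rewrite -mul_polyC polyCB polyC_exp polyCM polyC1 -[2%:P]/(1 + 1)%:P.
by rewrite polyCD polyC1; ring.
Qed.

End rodrigues.

Section trinomials_over_fields.
Variable K : fieldType.

(** The central coefficient depends on [a] and [d] through their product:
    substituting d w for w in a d + b w + w^2 gives d (a + b w + d w^2). *)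
Lemma coef_trinomial_exp_monic (a b d : K) l :
  (trinomial a b d ^+ l)`_l = (trinomial (a * d) b 1 ^+ l)`_l.
Proof.
have coef_nod (e : K) : (trinomial 0 b e ^+ l)`_l = b ^+ l.
  rewrite (_ : trinomial _ _ _ = 'X * (b%:P + e *: 'X)).
    by rewrite exprMn coefXnM ltnn subnn -!horner_coef0 horner_exp !hornerE.
  by rewrite /trinomial -!mul_polyC; ring.
(* For d = 0 both central coefficients are b ^+ l. *)
have [->|d0] := eqVneq d 0.
  have -> : trinomial a b 0 = trinomial a (1 * b) (0 * b ^+ 2).
    by rewrite mul1r mul0r.
  rewrite coef_trinomial_exp_scale mulr0 coef_nod.
  have -> : trinomial a 1 0 = 'X + a%:P.
    by rewrite /trinomial scale1r scale0r addr0 addrC.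
  by rewrite coef_exp_XaddC binn subnn expr0 mulr1.
have dl0 : d ^+ l != 0 by rewrite expf_neq0.
apply: (mulfI dl0); rewrite -[RHS]coef_trinomial_exp_scale -coefZ -exprZn.
have -> : d *: trinomial a b d = trinomial (a * d) (b * d) (1 * d ^+ 2).
  by rewrite /trinomial mul1r -!mul_polyC !polyCM; ring.
by [].
Qed.

Lemma coef_trinomial_exp_homogeneous (e b p : K) l :
  (trinomial (e ^+ 2 * p) (e * b) 1 ^+ l)`_l = e ^+ l * (trinomial p b 1 ^+ l)`_l.
Proof.
have H (q c : K) : (trinomial q c 1 ^+ l)`_l = (trinomial 1 c q ^+ l)`_l.
  by rewrite [RHS]coef_trinomial_exp_monic mul1r.
by rewrite !H [e * b]mulrC [e ^+ 2 * p]mulrC coef_trinomial_exp_scale.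
Qed.

End trinomials_over_fields.

Section legendre.
Context {R : realType}.

Lemma legendre_rodrigues l :
  legendre l = (2 ^+ l)^-1 *: (('X^2 - 1 : {poly R}) ^+ l)^`N(l).
Proof. by rewrite nderivn_exp_X2sub1. Qed.

Lemma horner_derivn_legendre l m (c : R) :
  ((legendre l)^`(m)).[c] =
  (2 ^+ l)^-1 * ((l + m)`!%:R / l`!%:R)
  * (trinomial (c ^+ 2 - 1) (2 * c) 1 ^+ l)`_(l + m).
Proof.
have l0 : l`!%:R != 0 :> R by rewrite pnatr_eq0 -lt0n fact_gt0.
rewrite -X2sub1_comp_shift.
have -> : (('X^2 - 1) \Po ('X + c%:P)) ^+ l = ('X^2 - 1) ^+ l \Po ('X + c%:P).
  by rewrite rmorphXn.
rewrite coef_comp_shift.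
rewrite legendre_rodrigues derivnZ hornerZ -mulrA; congr (_ * _).
apply: (mulfI l0).
rewrite mulrC mulr_natr -hornerMn -derivnMn -nderivn_def.
have -> : (('X^2 - 1 : {poly R}) ^+ l)^`(l)^`(m) = (('X^2 - 1) ^+ l)^`(l + m).
  by rewrite /derivn addnC iterD.
rewrite nderivn_def.
by rewrite hornerMn -mulr_natl mulrA mulrC; field.
Qed.

Lemma horner_legendre l (c : R) :
  (legendre l).[c] = (2 ^+ l)^-1 * (trinomial (c ^+ 2 - 1) (2 * c) 1 ^+ l)`_l.
Proof.
have := horner_derivn_legendre l 0 c; rewrite derivn0 => ->.
by rewrite addn0 divff ?mulr1// pnatr_eq0 -lt0n fact_gt0.
Qed.

End legendre.

(** By invertibility of the Vandermonde matrix of 0, 1, ..., n - 1. This carries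
    statements about the values of a family of polynomials over to their
    coefficients. *)
Lemma coef_interpolation (F : numFieldType) n j : (j < n)%N ->
  exists la : 'I_n -> F, forall p : {poly F}, (size p <= n)%N ->
    p`_j = \sum_(i < n) la i * p.[i%:R].
Proof.
move=> jn; pose x : 'rV[F]_n := \row_i (i : nat)%:R.
pose V := Vandermonde n x.
have uV : V \in unitmx.
  rewrite unitmxE det_Vandermonde unitfE; apply/prodf_neq0 => i _.
  apply/prodf_neq0 => k ik.
  by rewrite !mxE subr_eq0 eqr_nat neq_ltn ik orbT.
exists (fun i => invmx V i (Ordinal jn)) => p sp.
pose P : 'rV[F]_n := \row_k p`_k.
have PV i : (P *m V) 0 i = p.[i%:R].
  rewrite mxE (horner_coef_wide _ sp); apply: eq_bigr => k _.
  by rewrite !mxE.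
have := mulmxK uV P => /matrixP/(_ 0 (Ordinal jn)).
rewrite [RHS]mxE /= => <-; rewrite mxE; apply: eq_bigr => i _.
by rewrite PV mulrC.
Qed.

(** * Averages of powers of null forms over a circle *)

Section circle_average.
Context {R : realType}.
Local Notation leb := (@lebesgue_measure R).
Local Notation C := R[i].

Definition cis (h : R) : C := cos h +i* sin h.

Lemma cisD (a b : R) : cis (a + b) = cis a * cis b.
Proof. by rewrite /cis cosD sinD; simpc; congr (_ +i* _); ring. Qed.

Lemma cis0 : cis 0 = 1.
Proof. by rewrite /cis cos0 sin0. Qed.

Lemma cis_exp (h : R) n : cis h ^+ n = cis (n%:R * h).
Proof.
elim: n => [|n IH]; first by rewrite mul0r cis0.
by rewrite exprS IH -cisD -[n.+1%:R]natr1 mulrDl mul1r addrC.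
Qed.

Lemma cis_inv (h : R) : cis h * cis (- h) = 1.
Proof. by rewrite -cisD subrr cis0. Qed.

Lemma Re_mul (z w : C) :
  complex.Re (z * w) = complex.Re z * complex.Re w - complex.Im z * complex.Im w.
Proof. by case: z w => a b [c d]. Qed.

Lemma Rintegral_Re_cis (n : nat) (k : C) : (0 < n)%N ->
  \int[leb]_(h in `[0, 2 * pi]) complex.Re (k * cis (n%:R * h)) = 0.
Proof.
move=> n0; have nR : n%:R != 0 :> R by rewrite pnatr_eq0 -lt0n.
have pi20 : 0 <= 2 * pi :> R by rewrite mulr_ge0// pi_ge0.
case: k => a b.
pose F (h : R) := n%:R^-1 * (a * sin (n%:R * h) + b * cos (n%:R * h)).
have D (h : R) : is_derive h 1 F (a * cos (n%:R * h) - b * sin (n%:R * h)).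
  by apply: is_derive_eq; rewrite /GRing.scale/=; field.
under eq_Rintegral do rewrite Re_mul /=.
rewrite (Rintegral_derivative pi20 _ D); last by continuity.
rewrite /F mulr0 sin0 cos0.
have -> : n%:R * (2 * pi) = 0 + pi *+ 2 *+ n :> R.
  by rewrite add0r mulr_natl mulr_natl.
by rewrite (periodicn (@sinD2pi R)) (periodicn (@cosD2pi R)) sin0 cos0 subrr.
Qed.

Lemma Rintegral_Re_cis_neg (n : nat) (k : C) : (0 < n)%N ->
  \int[leb]_(h in `[0, 2 * pi]) complex.Re (k * cis (- (n%:R * h))) = 0.
Proof.
move=> n0; case: k => a b; rewrite -[RHS](Rintegral_Re_cis (a -i* b) n0).
by apply: eq_Rintegral => h _; rewrite !Re_mul /= sinN cosN; ring.
Qed.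

Lemma continuous_Re_cis (k : C) (n : R) :
  continuous (fun h : R => complex.Re (k * cis (n * h))).
Proof.
case: k => a b.
rewrite (_ : (fun _ => _) = (fun h => a * cos (n * h) - b * sin (n * h))).
  by continuity.
by apply/funext => h; rewrite Re_mul.
Qed.

Lemma Rintegral_sum_continuous (a b : R) n (g : nat -> R -> R) :
  (forall i, continuous (g i)) ->
  continuous (fun h => \sum_(i < n) g i h) /\
  \int[leb]_(h in `[a, b]) \sum_(i < n) g i h =
  \sum_(i < n) \int[leb]_(h in `[a, b]) g i h.
Proof.
move=> cg; elim: n => [|n [cs IH]].
  split.
    rewrite (_ : (fun h => _) = (fun=> 0)); first by continuity.
    by apply/funext => h; rewrite big_ord0.
  under eq_Rintegral do rewrite big_ord0.
  by rewrite Rintegral_cst// mul0r big_ord0.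
split.
  rewrite (_ : (fun h => _) = (fun h => \sum_(i < n) g i h + g n h)).
    by apply: continuous_addr.
  by apply/funext => h; rewrite big_ord_recr.
under eq_Rintegral do rewrite big_ord_recr.
rewrite RintegralD//; [|exact: integrable_continuous..].
by rewrite IH big_ord_recr.
Qed.

(** The trigonometric monomials other than the constant one integrate to 0. *)
Lemma Rintegral_Re_horner_cis (p : {poly C}) (mu : C) l :
  \int[leb]_(h in `[0, 2 * pi])
    complex.Re (mu * (cis (- (l%:R * h)) * p.[cis h])) =
  2 * pi * complex.Re (mu * p`_l).
Proof.
have pi20 : 0 < 2 * pi :> R by rewrite mulr_gt0// pi_gt0.
have term (k : C) i : \int[leb]_(h in `[0, 2 * pi])
    complex.Re (k * cis (- (l%:R * h)) * cis h ^+ i) =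
    (i == l)%:R * (2 * pi * complex.Re k).
  have [->|il] := eqVneq i l.
    rewrite mul1r (_ : (fun h => _) = cst (complex.Re k)).
      rewrite Rintegral_cst//= lebesgue_measure_itv/= lte_fin pi20.
      by rewrite -EFinB/= subr0 mulrC.
    by apply/funext => h; rewrite cis_exp -mulrA [cis _ * _]mulrC cis_inv mulr1.
  rewrite mul0r; have [li|li] := ltnP l i.
    rewrite -[RHS](@Rintegral_Re_cis (i - l) k) ?subn_gt0//.
    apply: eq_Rintegral => h _; rewrite cis_exp -mulrA -cisD natrB 1?ltnW//.
    by congr (complex.Re (_ * cis _)); ring.
  have {}li : (i < l)%N by rewrite ltn_neqAle il.
  rewrite -[RHS](@Rintegral_Re_cis_neg (l - i) k) ?subn_gt0//.
  apply: eq_Rintegral => h _; rewrite cis_exp -mulrA -cisD natrB 1?ltnW//.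
  by congr (complex.Re (_ * cis _)); ring.
have exponent i h : cis (- (l%:R * h)) * cis h ^+ i = cis ((i%:R - l%:R) * h).
  by rewrite cis_exp -cisD; congr cis; ring.
pose g i (h : R) := complex.Re (mu * p`_i * cis ((i%:R - l%:R) * h)).
have gE h : complex.Re (mu * (cis (- (l%:R * h)) * p.[cis h])) =
    \sum_(i < size p) g i h.
  rewrite horner_coef mulr_sumr mulr_sumr raddf_sum; apply: eq_bigr => i _.
  by rewrite /g -exponent; congr complex.Re; ring.
under eq_Rintegral do rewrite gE.
have cg i : continuous (g i) by exact: continuous_Re_cis.
rewrite (Rintegral_sum_continuous 0 (2 * pi) (size p) cg).2.
have gi i : \int[leb]_(h in `[0, 2 * pi]) g i h =
    (i == l)%:R * (2 * pi * complex.Re (mu * p`_i)).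
  by rewrite -term; apply: eq_Rintegral => h _; rewrite -mulrA exponent.
under eq_bigr do rewrite gi.
have [lp|pl] := ltnP l (size p).
  rewrite (bigD1 (Ordinal lp))//= eqxx mul1r big1 ?addr0// => i il.
  by rewrite (negbTE (_ : nat_of_ord i != l)) ?mul0r.
rewrite nth_default// mulr0 mulr0 big1// => i _.
rewrite (negbTE (_ : nat_of_ord i != l)) ?mul0r//.
by rewrite neq_ltn (leq_trans (ltn_ord i) pl).
Qed.

End circle_average.

Section null_forms.
Context {R : realType}.
Local Notation leb := (@lebesgue_measure R).
Local Notation C := R[i].

Lemma map_trinomial (A B : comNzRingType) (f : {rmorphism A -> B}) (a b d : A) :
  map_poly f (trinomial a b d) = trinomial (f a) (f b) (f d).
Proof.
rewrite /trinomial !rmorphD /= map_polyC !map_polyZ /= map_polyX map_polyXn.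
by [].
Qed.

Lemma cisE (h : R) : cis h = (cos h)%:C + 'i * (sin h)%:C.
Proof. by rewrite /cis [LHS]complexE. Qed.

(** For a complex vector e with e . e = 0 the average of (e . x)^l over the
    circle of points x at angular distance s from the pole involves e only
    through its component along the pole: as a trigonometric polynomial in the
    angle, e . x has extreme coefficients whose product is
    - (sin s)^2 e3^2 / 4, and the constant Fourier coefficient of the power
    depends on nothing but this product and the middle coefficient. *)
Lemma null_form_circle_average (e1 e2 e3 mu : C) (s : R) l :
  e1 ^+ 2 + e2 ^+ 2 + e3 ^+ 2 = 0 ->
  \int[leb]_(h in `[0, 2 * pi]) complex.Re (mu *
    (e1 * (sin s * cos h)%:C + e2 * (sin s * sin h)%:C + e3 * (cos s)%:C) ^+ l)
  = 2 * pi * (legendre l).[cos s] * complex.Re (mu * e3 ^+ l).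
Proof.
move=> e0.
pose ss : C := (sin s)%:C / 2.
pose T := trinomial (ss * (e1 + 'i * e2)) (e3 * (cos s)%:C) (ss * (e1 - 'i * e2)).
have TE h : e1 * (sin s * cos h)%:C + e2 * (sin s * sin h)%:C + e3 * (cos s)%:C
    = cis (- h) * T.[cis h].
  have q2 : cis (- h) * cis h = 1 by rewrite mulrC cis_inv.
  have -> : cis (- h) * T.[cis h] = ss * (e1 + 'i * e2) * cis (- h)
      + e3 * (cos s)%:C * (cis (- h) * cis h)
      + ss * (e1 - 'i * e2) * (cis (- h) * cis h) * cis h.
    by rewrite /T /trinomial !hornerD hornerC !hornerZ hornerX hornerXn; ring.
  rewrite q2 !mulr1 !cisE cosN sinN !rmorphM rmorphN /= /ss.
  have i2 : 'i ^+ 2 = -1 :> C by exact: sqr_i.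
  by field: i2.
have -> : (fun h => complex.Re (mu * (e1 * (sin s * cos h)%:C
     + e2 * (sin s * sin h)%:C + e3 * (cos s)%:C) ^+ l)) =
   (fun h => complex.Re (mu * (cis (- (l%:R * h)) * (T ^+ l).[cis h]))).
  apply/funext => h; rewrite TE exprMn cis_exp horner_exp.
  by rewrite mulrN.
rewrite Rintegral_Re_horner_cis coef_trinomial_exp_monic.
have -> : trinomial (ss * (e1 + 'i * e2) * (ss * (e1 - 'i * e2)))
    (e3 * (cos s)%:C) 1 =
  trinomial ((e3 / 2) ^+ 2 * (cos s ^+ 2 - 1)%:C) (e3 / 2 * (2 * cos s)%:C) 1.
  congr trinomial.
    rewrite -(cos2Dsin2 s) opprD addrA subrr add0r rmorphN rmorphXn /= /ss.
    have i2 : 'i ^+ 2 = -1 :> C by exact: sqr_i.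
    have e3E : e3 ^+ 2 = - (e1 ^+ 2 + e2 ^+ 2).
      by apply/eqP; rewrite -addr_eq0 addrC e0.
    by field: i2 e3E.
  by rewrite rmorphM rmorph_nat; field.
rewrite coef_trinomial_exp_homogeneous.
have -> : trinomial (cos s ^+ 2 - 1)%:C (2 * cos s)%:C 1 ^+ l =
  map_poly (real_complex R) (trinomial (cos s ^+ 2 - 1) (2 * cos s) 1 ^+ l).
  by rewrite rmorphXn /= map_trinomial rmorph1.
rewrite coef_map horner_legendre expr_div_n.
set t := (trinomial (cos s ^+ 2 - 1) (2 * cos s) 1 ^+ l)`_l.
have -> : mu * (e3 ^+ l / 2 ^+ l * real_complex R t) =
    ((2 ^+ l)^-1 * t)%:C * (mu * e3 ^+ l).
  by rewrite rmorphM fmorphV rmorphXn rmorph_nat /=; ring.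
rewrite [X in 2 * pi * X = _]Re_mul /= mul0r subr0.
by ring.
Qed.

End null_forms.

(** * Solid harmonics *)

Section C1_algebra.
Context {R : realType}.
Local Notation C := R[i].
Implicit Types g k : R -> R -> R -> R.

Lemma C1_space_cst (c : R) : C1_space (fun _ _ _ => c).
Proof.
exists (fun _ _ _ => 0), (fun _ _ _ => 0), (fun _ _ _ => 0).
split; [by continuity..|move=> x y z t dx dy dz _ _ _].
by apply: is_derive_eq (is_derive_cstr c t) _; ring.
Qed.

Lemma C1_space_form (a b c : R) : C1_space (fun x y z => a * x + b * y + c * z).
Proof.
exists (fun _ _ _ => a), (fun _ _ _ => b), (fun _ _ _ => c).
split; [by continuity..|move=> x y z t dx dy dz Dx Dy Dz].
apply: is_derive_eq (is_derive_addr (is_derive_addr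
  (is_derive_mulr (is_derive_cstr a t) Dx)
  (is_derive_mulr (is_derive_cstr b t) Dy))
  (is_derive_mulr (is_derive_cstr c t) Dz)) _.
by ring.
Qed.

Lemma C1_space_add g k : C1_space g -> C1_space k ->
  C1_space (fun x y z => g x y z + k x y z).
Proof.
move=> [g1 [g2 [g3 [cg c1 c2 c3 dg]]]] [k1 [k2 [k3 [ck d1 d2 d3 dk]]]].
exists (fun x y z => g1 x y z + k1 x y z), (fun x y z => g2 x y z + k2 x y z),
  (fun x y z => g3 x y z + k3 x y z).
split; [by continuity..|move=> x y z t dx dy dz Dx Dy Dz].
apply: is_derive_eq (is_derive_addr (dg x y z t _ _ _ Dx Dy Dz)
  (dk x y z t _ _ _ Dx Dy Dz)) _.
by ring.
Qed.

Lemma C1_space_mul g k : C1_space g -> C1_space k ->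
  C1_space (fun x y z => g x y z * k x y z).
Proof.
move=> [g1 [g2 [g3 [cg c1 c2 c3 dg]]]] [k1 [k2 [k3 [ck d1 d2 d3 dk]]]].
exists (fun x y z => g1 x y z * k x y z + g x y z * k1 x y z),
  (fun x y z => g2 x y z * k x y z + g x y z * k2 x y z),
  (fun x y z => g3 x y z * k x y z + g x y z * k3 x y z).
split; [by continuity..|move=> x y z t dx dy dz Dx Dy Dz].
apply: is_derive_eq (is_derive_mulr (dg x y z t _ _ _ Dx Dy Dz)
  (dk x y z t _ _ _ Dx Dy Dz)) _.
by ring.
Qed.

Definition C1_complex (F : R -> R -> R -> C) :=
  C1_space (fun x y z => complex.Re (F x y z)) /\
  C1_space (fun x y z => complex.Im (F x y z)).

Lemma eq_C1_complex (F G : R -> R -> R -> C) :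
  (forall x y z, F x y z = G x y z) -> C1_complex F -> C1_complex G.
Proof.
move=> FG; suff -> : F = G by [].
by apply/funext => x; apply/funext => y; apply/funext => z.
Qed.

Lemma C1_complex_cst (c : C) : C1_complex (fun _ _ _ => c).
Proof. by split; exact: C1_space_cst. Qed.

Lemma C1_complex_add (F G : R -> R -> R -> C) : C1_complex F -> C1_complex G ->
  C1_complex (fun x y z => F x y z + G x y z).
Proof.
move=> [F1 F2] [G1 G2].
apply: (@eq_C1_complex (fun x y z =>
  (complex.Re (F x y z) + complex.Re (G x y z))
  +i* (complex.Im (F x y z) + complex.Im (G x y z)))).
  by move=> x y z; case: (F x y z) => a b; case: (G x y z).
by split; apply: C1_space_add.
Qed.

Lemma C1_complex_mul (F G : R -> R -> R -> C) : C1_complex F -> C1_complex G ->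
  C1_complex (fun x y z => F x y z * G x y z).
Proof.
move=> [F1 F2] [G1 G2].
apply: (@eq_C1_complex (fun x y z =>
  (complex.Re (F x y z) * complex.Re (G x y z)
     + (- 1 * complex.Im (F x y z)) * complex.Im (G x y z))
  +i* (complex.Re (F x y z) * complex.Im (G x y z)
     + complex.Im (F x y z) * complex.Re (G x y z)))).
  move=> x y z; case: (F x y z) => a b; case: (G x y z) => c d /=.
  by simpc; congr (_ +i* _); rewrite mulN1r.
split; apply: C1_space_add; apply: C1_space_mul => //.
by apply: C1_space_mul => //; exact: C1_space_cst.
Qed.

Lemma C1_complex_exp (F : R -> R -> R -> C) n : C1_complex F ->
  C1_complex (fun x y z => F x y z ^+ n).
Proof.
move=> F1; elim: n => [|n IH]; first exact: C1_complex_cst.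
apply: (@eq_C1_complex (fun x y z => F x y z * F x y z ^+ n)).
  by move=> x y z; rewrite exprS.
exact: C1_complex_mul.
Qed.

Lemma C1_complex_sum n (F : 'I_n -> R -> R -> R -> C) :
  (forall i, C1_complex (F i)) ->
  C1_complex (fun x y z => \sum_(i < n) F i x y z).
Proof.
move=> F1; elim: n F F1 => [|n IH] F F1.
  apply: (@eq_C1_complex (fun _ _ _ => 0)); last exact: C1_complex_cst.
  by move=> x y z; rewrite big_ord0.
apply: (@eq_C1_complex (fun x y z =>
    F ord0 x y z + \sum_(i < n) F (lift ord0 i) x y z)).
  by move=> x y z; rewrite big_ord_recl.
by apply: C1_complex_add => //; exact: IH.
Qed.

End C1_algebra.

Section solid_harmonics.
Context {R : realType}.
Local Notation leb := (@lebesgue_measure R).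
Local Notation C := R[i].
Implicit Types (x y z a b h s : R) (t mu : C).

(** The vector [(t^2 - 1, - i (t^2 + 1), 2 t)] is null: its scalar product with
    itself vanishes, so that the powers of its product with the point are
    harmonic polynomials. *)
Definition null_form t x y z : C :=
  (t ^+ 2 - 1) * x%:C - 'i * (t ^+ 2 + 1) * y%:C + 2 * t * z%:C.

(** The coefficient of degree [j] in [t] of [null_form t x y z ^+ l]: a harmonic
    polynomial, homogeneous of degree [l], whose restriction to the sphere has
    order [l - j]. *)
Definition solid_harm l j x y z : C :=
  (trinomial (- (x +i* y)) (2 * z)%:C (x -i* y) ^+ l)`_j.

Lemma solid_harm_null_forms l j : (j <= l.*2)%N ->
  exists la : 'I_l.*2.+1 -> C, forall x y z,
    solid_harm l j x y z = \sum_i la i * null_form i%:R x y z ^+ l.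
Proof.
move=> jl; have [la laP] := coef_interpolation C (jl : (j < l.*2.+1)%N).
exists la => x y z; rewrite /solid_harm laP.
  apply: eq_bigr => i _; rewrite horner_exp; congr (_ * _ ^+ _).
  rewrite /null_form /trinomial !hornerD hornerC !hornerZ hornerX hornerXn.
  have -> : x +i* y = x%:C + 'i * y%:C by rewrite [LHS]complexE.
  have -> : x -i* y = x%:C - 'i * y%:C.
    by rewrite [LHS]complexE /= rmorphN mulrN.
  rewrite rmorphM rmorph_nat /=.
  by ring.
have s3 : (size (trinomial (- (x +i* y)) (2 * z)%:C (x -i* y)) <= 3)%N.
  rewrite /trinomial (leq_trans (size_polyD _ _))// geq_max.
  rewrite (leq_trans (size_polyD _ _)) ?geq_max ?(leq_trans (size_scale_leq _ _))
    ?size_polyXn ?size_polyX//.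
  by rewrite (leq_trans (size_polyC_leq1 _)).
apply: leq_trans (size_poly_exp_leq _ _) _.
rewrite ltnS -mul2n leq_mul2r; apply/orP; right.
by move: s3; case: (size _).
Qed.

Lemma C1_null_form t : C1_complex (null_form t).
Proof.
case: t => u v.
pose p := u ^+ 2 - v ^+ 2; pose q := 2 * u * v.
apply: (@eq_C1_complex _ (fun x y z => ((p - 1) * x + q * y + (2 * u) * z)
   +i* (q * x + (- (p + 1)) * y + (2 * v) * z))).
  move=> x y z; rewrite /null_form.
  have -> : (u +i* v) ^+ 2 = p +i* q.
    by rewrite expr2; simpc; congr (_ +i* _); rewrite /p /q; ring.
  have -> : 2 * (u +i* v) = (2 * u) +i* (2 * v).
    by rewrite !mulr_natl !mulr2n; simpc.
  by simpc; congr (_ +i* _); rewrite /=; ring.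
by split; exact: C1_space_form.
Qed.

Lemma C1_solid_harm l j mu : (j <= l.*2)%N ->
  C1_space (fun x y z => complex.Re (mu * solid_harm l j x y z)).
Proof.
move=> /solid_harm_null_forms[la laP].
suff [] : C1_complex (fun x y z => mu * solid_harm l j x y z) by [].
apply: (@eq_C1_complex _ (fun x y z =>
   mu * \sum_i la i * null_form i%:R x y z ^+ l)).
  by move=> x y z; rewrite laP.
apply: C1_complex_mul; first exact: C1_complex_cst.
apply: C1_complex_sum => i; apply: C1_complex_mul; first exact: C1_complex_cst.
exact/C1_complex_exp/C1_null_form.
Qed.

(** The frame [rotU a *m rotV b] takes the centre of the circle to the pole. *)
Lemma null_form_on_orbit t a b h s :
  null_form t (orbit_x a b h s) (orbit_y a b h s) (orbit_z a b h s) =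
  null_form t (cos a * cos b) (sin a * cos b) (- sin b) * (sin s * cos h)%:C
  + null_form t (- sin a) (cos a) 0 * (sin s * sin h)%:C
  + null_form t (cos a * sin b) (sin a * sin b) (cos b) * (cos s)%:C.
Proof.
rewrite /null_form /orbit_x /orbit_y /orbit_z.
by rewrite !(rmorphB, rmorphD, rmorphN, rmorphM, rmorph0) /=; ring.
Qed.

(** Rotations preserve the bilinear scalar product, hence null vectors. *)
Lemma null_form_frame t a b :
  null_form t (cos a * cos b) (sin a * cos b) (- sin b) ^+ 2
  + null_form t (- sin a) (cos a) 0 ^+ 2
  + null_form t (cos a * sin b) (sin a * sin b) (cos b) ^+ 2 = 0.
Proof.
have i2 : 'i ^+ 2 = -1 :> C by exact: sqr_i.
have a2 : (cos a)%:C ^+ 2 = 1 - (sin a)%:C ^+ 2 :> C.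
  by rewrite -!rmorphXn -(rmorph1 (real_complex R)) -rmorphB -(cos2Dsin2 a) addrK.
have b2 : (cos b)%:C ^+ 2 = 1 - (sin b)%:C ^+ 2 :> C.
  by rewrite -!rmorphXn -(rmorph1 (real_complex R)) -rmorphB -(cos2Dsin2 b) addrK.
rewrite /null_form !(rmorphN, rmorphM, rmorph0) /=.
by ring: i2 a2 b2.
Qed.

Lemma null_form_orbit_average l a b s t mu :
  \int[leb]_(h in `[0, 2 * pi]) complex.Re (mu *
    null_form t (orbit_x a b h s) (orbit_y a b h s) (orbit_z a b h s) ^+ l) =
  2 * pi * (legendre l).[cos s] * complex.Re (mu *
    null_form t (cos a * sin b) (sin a * sin b) (cos b) ^+ l).
Proof.
under eq_Rintegral do rewrite null_form_on_orbit.
by rewrite null_form_circle_average// null_form_frame.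
Qed.

(** The mean value property of harmonics on circles of the sphere: it is
    inherited from the powers of null forms by linearity. *)
Lemma solid_harm_orbit_average l j a b s mu : (j <= l.*2)%N ->
  \int[leb]_(h in `[0, 2 * pi]) complex.Re (mu *
    solid_harm l j (orbit_x a b h s) (orbit_y a b h s) (orbit_z a b h s)) =
  2 * pi * (legendre l).[cos s] * complex.Re (mu *
    solid_harm l j (cos a * sin b) (sin a * sin b) (cos b)).
Proof.
move=> /solid_harm_null_forms[la laP].
pose la' (i : nat) := if insub i is Some i' then la i' else 0.
have la'E (i : 'I_l.*2.+1) : la' i = la i by rewrite /la' valK.
pose g (i : nat) h := complex.Re (mu * la' i *
  null_form i%:R (orbit_x a b h s) (orbit_y a b h s) (orbit_z a b h s) ^+ l).
have cg i : continuous (g i).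
  have [[? [? [? [c _ _ _ _]]]] _] : C1_complex (fun x y z =>
      mu * la' i * null_form i%:R x y z ^+ l).
    apply: C1_complex_mul; first exact: C1_complex_cst.
    exact/C1_complex_exp/C1_null_form.
  rewrite /g; apply: (continuous_comp3 (K := fun x y z =>
      complex.Re (mu * la' i * null_form i%:R x y z ^+ l))) => //.
  - by rewrite /orbit_x; continuity.
  - by rewrite /orbit_y; continuity.
  - by rewrite /orbit_z; continuity.
transitivity (\int[leb]_(h in `[0, 2 * pi]) \sum_(i < l.*2.+1) g i h).
  apply: eq_Rintegral => h _; rewrite laP mulr_sumr raddf_sum.
  by apply: eq_bigr => i _; rewrite /g la'E mulrA.
rewrite (Rintegral_sum_continuous 0 (2 * pi) l.*2.+1 cg).2 laP mulr_sumr.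
rewrite raddf_sum mulr_sumr; apply: eq_bigr => i _.
by rewrite null_form_orbit_average la'E mulrA.
Qed.

End solid_harmonics.

Section funk_hecke.
Context {R : realType}.
Local Notation leb := (@lebesgue_measure R).
Local Notation C := R[i].

(** The circle mean is moved from [g] to the harmonic, of which it is a
    multiple. *)
Lemma funk_hecke (g : R -> R -> R -> R) l j (mu : C) (s : R) :
  C1_space g -> (j <= l.*2)%N -> 0 <= s ->
  let k a b := complex.Re (mu * solid_harm l j
    (cos a * sin b) (sin a * sin b) (cos b)) in
  \int[leb]_(a in `[0, 2 * pi]) \int[leb]_(b in `[0, pi])
    ((\int[leb]_(h in `[0, 2 * pi]) on_orbit g a b h s) * (k a b * sin b)) =
  2 * pi * (legendre l).[cos s] *
  \int[leb]_(a in `[0, 2 * pi]) \int[leb]_(b in `[0, pi])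
    (g (cos a * sin b) (sin a * sin b) (cos b) * (k a b * sin b)).
Proof.
move=> C1g jl s0 k.
pose K x y z := complex.Re (mu * solid_harm l j x y z).
have C1k : C1_space K by exact: C1_solid_harm.
have cg : continuous (fun v : R * R * R => g v.1.1 v.1.2 v.2).
  by case: C1g => ? [? [? []]].
have cK : continuous (fun v : R * R * R => K v.1.1 v.1.2 v.2).
  by case: C1k => ? [? [? []]].
have cgo := continuous_on_orbit cg.
have cKo := continuous_on_orbit cK.
have orbit0 (f : R -> R -> R -> R) a b h :
    on_orbit f a b h 0 = f (cos a * sin b) (sin a * sin b) (cos b).
  rewrite /on_orbit /orbit_x /orbit_y /orbit_z sin0 cos0.
  by congr (f _ _ _); ring.
have ck : continuous (fun v : R * R => k v.1 v.2).
  by rewrite /k; apply: (continuous_comp3 cK); continuity.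
have := circle_mean_symmetric C1g C1k s0.
rewrite [X in X = _ -> _](_ : _ = \int[leb]_(a in `[0, 2 * pi])
  \int[leb]_(b in `[0, pi])
    ((\int[leb]_(h in `[0, 2 * pi]) on_orbit g a b h s) * (k a b * sin b))).
  move=> ->.
  rewrite -RintegralZl//; last first.
    by apply: integrable_continuous; continuity.
  apply: eq_Rintegral => a _; rewrite -RintegralZl//; last first.
    by apply: integrable_continuous; continuity.
  apply: eq_Rintegral => b _.
  transitivity (\int[leb]_(h in `[0, 2 * pi])
      (sin b * g (cos a * sin b) (sin a * sin b) (cos b) * on_orbit K a b h (- s))).
    by apply: eq_Rintegral => h _; rewrite orbit0 mulrA.
  rewrite RintegralZl//; last by apply: integrable_continuous; continuity.
  by rewrite /on_orbit /K solid_harm_orbit_average// cosN -/(k a b); ring.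
apply: eq_Rintegral => a _; apply: eq_Rintegral => b _.
rewrite -RintegralZr//; last by apply: integrable_continuous; continuity.
by apply: eq_Rintegral => h _; rewrite orbit0 -/(k a b); ring.
Qed.

End funk_hecke.

Section spherical_harmonics.
Context {R : realType}.
Local Notation C := R[i].

(** Put s = sin phi and substitute w / (s exp(- i theta)) for w: the trinomial
    - s exp(i theta) + 2 cos phi w + s exp(- i theta) w^2 becomes, up to a
    factor, the expansion (cos phi + w)^2 - 1 of the Rodrigues formula. *)
Lemma solid_harm_polar l n (theta phi : R) : sin phi != 0 ->
  solid_harm l (l + n)
    (cos theta * sin phi) (sin theta * sin phi) (cos phi) =
  (sin phi ^+ n * (2 ^+ l * (l`!%:R / (l + n)`!%:R)
    * ((legendre l)^`(n)).[cos phi]))%:C * cis (- (n%:R * theta)).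
Proof.
move=> s0; pose k : C := (sin phi)%:C * cis (- theta).
have k0 : k != 0.
  rewrite mulf_neq0//.
    by rewrite -(rmorph0 (real_complex R)) (inj_eq (fmorph_inj _)).
  apply/eqP => c0; have := cis_inv theta; rewrite c0 mulr0 => /esym/eqP.
  by rewrite oner_eq0.
pose T : {poly R} := trinomial (cos phi ^+ 2 - 1) (2 * cos phi) 1.
have kT : k *: trinomial
      (- ((cos theta * sin phi) +i* (sin theta * sin phi)))
      (2 * cos phi)%:C
      ((cos theta * sin phi) -i* (sin theta * sin phi)) =
    trinomial (cos phi ^+ 2 - 1)%:C ((2 * cos phi)%:C * k) (1 * k ^+ 2).
  have -> : (cos theta * sin phi) +i* (sin theta * sin phi) =
      (sin phi)%:C * cis theta.
    by rewrite /cis; simpc; congr (_ +i* _); ring.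
  have kE : (cos theta * sin phi) -i* (sin theta * sin phi) = k.
    by rewrite /k /cis cosN sinN; simpc; congr (_ +i* _); ring.
  rewrite kE /trinomial !scalerDr !scalerA scale_polyC mul1r.
  congr (_%:P + _ *: _ + _).
  - rewrite -(cos2Dsin2 phi) opprD addrA subrr add0r rmorphN rmorphXn /=.
    rewrite /k mulrN mulrACA [cis _ * _]mulrC cis_inv mulr1 -expr2.
    by [].
  - by rewrite mulrC.
rewrite /solid_harm; apply: (mulfI (expf_neq0 l k0)).
rewrite -coefZ -exprZn kT coef_trinomial_exp_scale exprD -mulrA; congr (_ * _).
rewrite (_ : trinomial _ _ _ = map_poly (real_complex R) T); last first.
  by rewrite map_trinomial rmorph1.
rewrite -rmorphXn /= coef_map /= horner_derivn_legendre -/T.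
rewrite /k exprMn cis_exp mulrN -rmorphXn mulrAC -rmorphM /=.
congr (_%:C * _); congr (_ * _).
have l0 : l`!%:R != 0 :> R by rewrite pnatr_eq0 -lt0n fact_gt0.
have n0 : (l + n)`!%:R != 0 :> R by rewrite pnatr_eq0 -lt0n fact_gt0.
have e0 : 2 ^+ l != 0 :> R by rewrite expf_neq0// pnatr_eq0.
by field; rewrite n0 l0 e0.
Qed.

Lemma sqrt_sin (phi : R) : phi \in `[0, pi] ->
  Num.sqrt (1 - cos phi ^+ 2) = sin phi.
Proof.
move=> /sin_ge0_pi s0; rewrite -(cos2Dsin2 phi) addrAC subrr add0r.
by rewrite sqrtr_sqr ger0_norm.
Qed.

Lemma Re_mul_conj (nu w : C) :
  complex.Re (nu * Num.conj w) = complex.Re (Num.conj nu * w).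
Proof. by case: nu w => a b [c d]; rewrite !Re_mul /=; ring. Qed.

Lemma solid_harm_assoc_legendre l n (theta phi : R) :
  phi \in `[0, pi] -> sin phi != 0 ->
  (assoc_legendre_nat l n (cos phi))%:C * cis (- (n%:R * theta)) =
  ((-1) ^+ n * ((2 ^+ l)^-1 * ((l + n)`!%:R / l`!%:R)))%:C *
  solid_harm l (l + n)
    (cos theta * sin phi) (sin theta * sin phi) (cos phi).
Proof.
move=> phi0 s0; rewrite solid_harm_polar// mulrA -rmorphM /=.
rewrite /assoc_legendre_nat sqrt_sin//; congr (_%:C * _).
have l0 : l`!%:R != 0 :> R by rewrite pnatr_eq0 -lt0n fact_gt0.
have n0 : (l + n)`!%:R != 0 :> R by rewrite pnatr_eq0 -lt0n fact_gt0.
have e0 : 2 ^+ l != 0 :> R by rewrite expf_neq0// pnatr_eq0.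
by field; rewrite n0 l0 e0.
Qed.

Lemma conj_scale_cis (r u : R) : Num.conj (r%:C * cis u) = r%:C * cis (- u).
Proof.
rewrite /cis cosN sinN; apply/eqP; rewrite eq_complex /=.
by apply/andP; split; apply/eqP; ring.
Qed.

(** Away from the poles the real part of a multiple of the conjugate of a
    spherical harmonic is the restriction of that of a solid harmonic; negative
    orders are conjugate to positive ones. *)
Lemma Re_conj_sph_harm l (m : int) (nu : C) : exists mu : C,
  forall theta phi : R, phi \in `[0, pi] -> sin phi != 0 ->
  complex.Re (nu * Num.conj (sph_harm l m theta phi)) =
  complex.Re (mu * solid_harm l (l + absz m)
    (cos theta * sin phi) (sin theta * sin phi) (cos phi)).
Proof.
pose coef := (-1) ^ m * Num.sqrt (((2 * l + 1)%:R * (absz (l%:Z - m))`!%:R)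
  / (4 * pi * (absz (l%:Z + m))`!%:R)) : R.
pose n := absz m.
pose norm : R := (-1) ^+ n * ((2 ^+ l)^-1 * ((l + n)`!%:R / l`!%:R)).
case: m @n @norm @coef => k n norm coef.
  exists (nu * coef%:C * norm%:C) => theta phi phi0 s0.
  rewrite /sph_harm /assoc_legendre -/coef.
  rewrite (_ : _ +i* _ = cis (k%:R * theta)) // conj_scale_cis rmorphM /=.
  rewrite -[_ * _ * cis _]mulrA solid_harm_assoc_legendre//.
  by rewrite [X in X%:C * solid_harm _ _ _ _ _](_ : _ = norm)// !mulrA.
pose d : R := (-1) ^+ k.+1 * ((l - k.+1)`!%:R / (l + k.+1)`!%:R).
exists (Num.conj nu * (coef * d)%:C * norm%:C) => theta phi phi0 s0.
rewrite /sph_harm /assoc_legendre -/coef -/d Re_mul_conj.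
rewrite (_ : _ +i* _ = cis (- (k.+1%:R * theta))); last first.
  by rewrite /cis NegzE mulrNz mulNr.
have -> x : (coef * (d * x))%:C = (coef * d)%:C * x%:C.
  by rewrite mulrA rmorphM.
rewrite -[_ * _ * cis _]mulrA.
rewrite solid_harm_assoc_legendre//.
by rewrite [X in X%:C * solid_harm _ _ _ _ _](_ : _ = norm)// !mulrA.
Qed.

End spherical_harmonics.

(** * Integrability of the density *)

Section clamped_functions.
Context {R : realType}.
Variables a b : R.
Hypothesis ab : a <= b.
Implicit Types p dp : R -> R.

Definition clamp (x : R) : R := Num.max a (Num.min x b).

Lemma clamp_itv x : clamp x \in `[a, b].
Proof. by rewrite in_itv/= /clamp le_max lexx ge_max ab ge_min lexx orbT. Qed.

Lemma clamp_id x : x \in `[a, b] -> clamp x = x.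
Proof.
by rewrite in_itv/= => /andP[ax xb]; rewrite /clamp (min_idPl xb) (max_idPr ax).
Qed.

Lemma clamp_cases x : [\/ x <= a /\ clamp x = a, [/\ a <= x, x <= b & clamp x = x] |
  b <= x /\ clamp x = b].
Proof.
have [xa|/ltW ax] := leP x a.
  apply: Or31; split => //; rewrite /clamp (min_idPl _) ?(max_idPl _)//.
  exact: le_trans ab.
have [xb|/ltW bx] := leP x b.
  by apply: Or32; split => //; rewrite /clamp (min_idPl _) ?(max_idPr _).
by apply: Or33; split => //; rewrite /clamp (min_idPr _) ?(max_idPr _).
Qed.

Lemma clamp_lipschitz x y : `|clamp x - clamp y| <= `|x - y|.
Proof.
have h1 := ler_norm (x - y); have h2 := ler_norm (y - x).
rewrite distrC in h2; rewrite ler_norml; apply/andP.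
have h0 := ab.
by case: (clamp_cases x) => -[]; case: (clamp_cases y) => -[] => *; split; lra.
Qed.

Lemma continuous_clamped p :
  {within `[a, b], continuous p} -> continuous (p \o clamp).
Proof.
move=> /subspace_continuousP cp x; apply/cvgrPdist_lt => e e0.
have /cvgrPdist_lt/(_ e e0) [d /= d0 dp] := cp _ (clamp_itv x).
near=> y; apply: dp; last exact: clamp_itv.
by rewrite /= (le_lt_trans (clamp_lipschitz _ _)).
Unshelve. all: by end_near.
Qed.

(** At interior points the one-sided quotients are two-sided, and existence of
    the quotients gives continuity up to the end points. *)
Lemma C1_on_continuous_derivable p : C1_on a b p -> exists dp,
  [/\ {within `[a, b], continuous dp}, {within `[a, b], continuous p} &
      forall x, x \in `]a, b[ -> is_derive x 1 p (dp x)].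
Proof.
move=> [dp [cdp pdp]]; exists dp; split => //.
  apply/subspace_continuousP => x xab; apply/cvgrPdist_lt => e e0.
  have /cvgrPdist_lt/(_ 1 ltr01) [d /= d0 dP] := pdp x xab.
  have c0 : 0 < `|dp x| + 1 by rewrite ltr_wpDl.
  rewrite /prop_near1 nbhs_simpl /within /=; near=> y; move=> yab.
  have [->|yx] := eqVneq y x; first by rewrite subrr normr0.
  have dxy : `|x - y| < d by near: y; exact: cvgr_dist_lt.
  have exy : `|x - y| < e / (`|dp x| + 1).
    by near: y; apply: cvgr_dist_lt => //; rewrite divr_gt0.
  have {dP}q1 := dP y dxy yx yab.
  have q2 : `|(p y - p x) / (y - x)| < `|dp x| + 1.
    rewrite -[X in `|X|](subKr (dp x)) (le_lt_trans (ler_normB _ _))//.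
    by rewrite ltrD2l.
  have xy0 : 0 < `|y - x| by rewrite normr_gt0 subr_eq0.
  rewrite distrC -[p y - p x](divfK (_ : y - x != 0)) ?subr_eq0// normrM.
  rewrite (lt_trans (_ : _ < (`|dp x| + 1) * `|y - x|)) ?ltr_pM2r//.
  by rewrite mulrC -ltr_pdivlMr// distrC.
move=> x xab.
have xab' : x \in `[a, b] by exact: subset_itv_oo_cc xab.
apply/is_derive_quotient; apply/cvgrPdist_lt => e e0.
have /cvgrPdist_lt/(_ e e0) [d /= d0 dP] := pdp x xab'.
have [d' /= d'0 d'P] : nbhs x [set y | y \in `]a, b[].
  by apply: open_nbhs_nbhs; split => //; exact: itv_open.
near=> h.
have h0 : h != 0 by near: h; exact: nbhs_dnbhs_neq.
have hd : `|h| < Num.min d d'.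
  near: h; apply: dnbhs0_lt; by rewrite lt_min d0.
rewrite lt_min in hd; move/andP: hd => [hd hd'].
have := dP (h + x); rewrite addrK mulrC; apply.
- by rewrite /ball /= opprD addrCA subrr addr0 normrN.
- by rewrite -subr_eq0 addrK.
- apply: subset_itv_oo_cc; apply: d'P.
  by rewrite /ball /= opprD addrCA subrr addr0 normrN.
Unshelve. all: by end_near.
Qed.

End clamped_functions.

Section curve_angle.
Context {R : realType}.
Variable r : R.
Hypothesis r0 : 0 <= r.
Hypothesis r1 : r <= 1.

Lemma cos_pihalf_pi_lt0 (phi : R) : pi / 2 < phi < pi -> cos phi < 0.
Proof.
move=> /andP[a b]; rewrite -oppr_gt0.
have -> : - cos phi = cos (pi - phi) by rewrite cosB cospi sinpi; ring.
by apply: cos_gt0_pihalf; have := pi_gt0 R => ?; apply/andP; split; lra.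
Qed.

Lemma scaled_sin_itv (phi : R) : phi \in `[0, pi] -> 0 <= r * sin phi <= 1.
Proof.
move=> /sin_ge0_pi s0; rewrite mulr_ge0//= (le_trans _ (sin_le1 phi))//.
by rewrite ler_piMl.
Qed.

Lemma scaled_sin_lt1 (phi : R) : phi \in `]0, pi[ -> phi != pi / 2 ->
  0 <= r * sin phi < 1.
Proof.
rewrite in_itv/= => /andP[p0 ppi] pn; have s0 : 0 < sin phi.
  by apply: sin_gt0_pi; rewrite p0.
suff s1 : sin phi < 1.
  apply/andP; split; first by rewrite mulr_ge0// ltW.
  by apply: le_lt_trans s1; rewrite ler_piMl// ltW.
have c0 : 0 < cos phi ^+ 2.
  rewrite exprn_even_gt0//=; have [lt|gt|e] := ltgtP phi (pi / 2).
  - rewrite gt_eqF// cos_gt0_pihalf// lt andbT (lt_trans _ p0)// oppr_lt0.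
    by rewrite divr_gt0// pi_gt0.
  - by rewrite lt_eqF// cos_pihalf_pi_lt0// gt.
  - by rewrite e eqxx in pn.
have := cos2Dsin2 phi => e; rewrite ltNge; apply/negP => s1.
have : 1 <= sin phi ^+ 2 by rewrite exprn_ege1.
by rewrite -e leNgt ltrDr c0.
Qed.

Lemma asin_pos (x : R) : 0 < x < 1 -> asin x \in `]0, pi / 2[.
Proof.
move=> /andP[x0 x1]; have x1' : -1 <= x < 1 by lra.
rewrite in_itv/= asin_ltpi2// andbT ltNge; apply/negP => a0.
have pi0 := pi_gt0 R.
have := @asin_geNpi2 _ x ltac:(lra) => a1.
have : 0 <= sin (- asin x) by apply: sin_ge0_pi; lra.
by rewrite sinN asinK ?in_itv/=; lra.
Qed.

Let slope (phi : R) : R := r * cos phi / Num.sqrt (1 - (r * sin phi) ^+ 2).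

Lemma is_derive_asin_scaled_sin (phi : R) : phi \in `]0, pi[ ->
  phi != pi / 2 -> is_derive phi 1 (fun s => asin (r * sin s)) (slope phi).
Proof.
move=> p0 pn; have /andP[a b] := scaled_sin_lt1 p0 pn.
have D1 : is_derive (r * sin phi) 1 (@asin R)
    (Num.sqrt (1 - (r * sin phi) ^+ 2))^-1 by apply: is_derive1_asin; lra.
have D2 := is_derive_mulr (is_derive_cstr r phi) (is_derive_sin phi).
apply: is_derive_eq (@is_derive1_comp _ _ (fun s => r * sin s) phi _ _ D1 D2) _.
by rewrite mul0r add0r mulrC.
Qed.

(** Since (r cos phi)^2 <= 1 - (r sin phi)^2; where the denominator vanishes the
    quotient is 0 by convention. *)
Lemma slope_le1 (phi : R) : `|slope phi| <= 1.
Proof.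
rewrite /slope normrM normfV [`|Num.sqrt _|]ger0_norm ?sqrtr_ge0//.
have le : `|r * cos phi| <= Num.sqrt (1 - (r * sin phi) ^+ 2).
  rewrite -sqrtr_sqr ler_sqrt.
  - have := cos2Dsin2 phi; have : r ^+ 2 <= 1 by rewrite expr_le1.
    by rewrite !exprMn => ? ?; nra.
  - have : sin phi ^+ 2 <= 1 by rewrite -(cos2Dsin2 phi) lerDr sqr_ge0.
    have : r ^+ 2 <= 1 by rewrite expr_le1.
    have := sqr_ge0 r; have := sqr_ge0 (sin phi).
    by rewrite exprMn => ? ? ? ?; nra.
have [->|nz] := eqVneq (Num.sqrt (1 - (r * sin phi) ^+ 2)) 0.
  by rewrite invr0 mulr0.
by rewrite ler_pdivrMr ?mul1r// lt_neqAle eq_sym nz sqrtr_ge0.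
Qed.

(** For r < 1 the angle is smooth in phi. For r = 1 it is the distance of phi to
    the nearer end of the interval, which has a corner at pi / 2. *)
Lemma curve_angle : exists u v : R -> R,
  [/\ continuous u, measurable_fun setT v,
      forall phi, `|v phi| <= 1,
      forall phi, phi \in `[0, pi] -> u phi = asin (r * sin phi) &
      forall phi, phi \in `]0, pi[ -> phi != pi / 2 ->
        is_derive phi 1 (fun s => asin (r * sin s)) (v phi)].
Proof.
have [rl1|] := ltP r 1.
  have lt1 phi : -1 < r * sin phi < 1.
    have : `|r * sin phi| < 1.
      rewrite normrM (ger0_norm r0) (le_lt_trans _ rl1)// ler_piMr// ler_norml.
      by rewrite sin_geN1 sin_le1.
    by rewrite ltr_norml.
  have crs : continuous (fun s : R => r * sin s) by continuity.
  have crc : continuous (fun s : R => r * cos s) by continuity.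
  have crq : continuous (fun s : R => 1 - (r * sin s) * (r * sin s)).
    by continuity.
  exists (fun phi => asin (r * sin phi)), slope; split => //.
  - move=> phi; apply: (@continuous_comp _ _ _ (fun s => r * sin s) asin).
      exact: crs.
    exact: continuous_asin.
  - apply: continuous_measurable_fun => phi.
    apply: cvgM; first exact: crc.
    apply: cvgV.
      rewrite gt_eqF// sqrtr_gt0; have /andP[] := lt1 phi.
      by move: (r * sin phi) => x ? ?; nra.
    apply: continuous_comp; last exact: sqrt_continuous.
    exact: crq.
  - exact: slope_le1.
  - exact: is_derive_asin_scaled_sin.
move=> r1'; have {r1'}r1E : r = 1 by apply/eqP; rewrite eq_le r1.
exists (fun phi => pi / 2 - `|phi - pi / 2|),
  (fun phi => if phi < pi / 2 then 1 else -1); split.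
- move=> phi; apply: cvgB; first exact: cvg_cst.
  by apply: cvg_norm; apply: cvgB; [exact: cvg_id|exact: cvg_cst].
- apply: measurable_fun_ifT => //.
  by apply: measurable_fun_ltr => //; exact: measurable_cst.
- by move=> phi; case: ifP => _; rewrite ?normrN normr1.
- move=> phi; rewrite in_itv/= => /andP[p0 ppi]; rewrite r1E mul1r.
  have pi0 := pi_gt0 R.
  have [le|/ltW ge] := leP phi (pi / 2).
    rewrite sinK; last by rewrite in_itv/=; lra.
    by rewrite ler0_norm; lra.
  have -> : sin phi = sin (pi - phi) by rewrite sinB cospi sinpi; ring.
  rewrite sinK; last by rewrite in_itv/=; lra.
  by rewrite ger0_norm; lra.
- move=> phi p0 pn; apply: is_derive_eq (is_derive_asin_scaled_sin p0 pn) _.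
  have c2 : 1 - sin phi ^+ 2 = cos phi ^+ 2 by rewrite -(cos2Dsin2 phi) addrK.
  rewrite /slope r1E !mul1r c2 sqrtr_sqr.
  have pi0 := pi_gt0 R.
  move: p0; rewrite in_itv/= => /andP[p0 ppi].
  case: ltgtP pn => // cmp _.
    have c0 : 0 < cos phi.
      apply: cos_gt0_pihalf; rewrite cmp andbT (lt_trans _ p0)//.
      by rewrite oppr_lt0 divr_gt0.
    by rewrite gtr0_norm// divff// gt_eqF.
  have c0 : cos phi < 0 by apply: cos_pihalf_pi_lt0; rewrite cmp.
  by rewrite ltr0_norm// invrN mulrN divff// lt_eqF.
Qed.

End curve_angle.

Section density.
Context {R : realType}.
Local Notation leb := (@lebesgue_measure R).

Lemma integrable_modify_point (a b : R) (g : R -> R) (e c : R) :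
  leb.-integrable `[a, b] (EFin \o g) ->
  leb.-integrable `[a, b] (EFin \o (fun x => if x == e then c else g x)).
Proof.
move=> ig.
have i1 : leb.-integrable `[a, b] (fun x => ((c - g e)%:E * (\1_[set e] x)%:E)%E).
  apply: integrableZl => //; apply: (@integrableS _ _ _ leb setT) => //.
  by rewrite -set_itv1; exact: (integrable_indic_itv e e true false).
have mab : measurable `[a, b]%classic by exact: measurable_itv.
have iS := @integrableD _ _ _ leb _ mab _ _ ig i1.
apply: eq_integrable iS => // x _ /=.
rewrite -EFinM -EFinD indicE in_set1.
by case: eqVneq => [->|_]; rewrite ?mulr1 ?mulr0 ?addr0// addrC subrK.
Qed.

Lemma integrable_bounded_mul (a b : R) (w B : R -> R) (M : R) :
  leb.-integrable `[a, b] (EFin \o w) -> measurable_fun setT B ->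
  (forall x, x \in `[a, b] -> `|B x| <= M) ->
  leb.-integrable `[a, b] (EFin \o (fun x => w x * B x)).
Proof.
move=> iw mB BM.
have iM : leb.-integrable `[a, b] (fun x => (M%:E * (EFin \o w) x)%E).
  exact: integrableZl.
apply: le_integrable iM => //.
- apply/measurable_EFinP; apply: measurable_funM.
    by apply/measurable_EFinP; case/integrableP : iw.
  exact: measurable_funS mB.
- move=> x xab /=; rewrite lee_fin !normrM mulrC ler_wpM2r//.
  by rewrite (le_trans (BM _ xab))// ler_norm.
Qed.

(** The speed of the angle asin (r sin phi) is at most 1, so that the factor of
    [w r phi] is bounded; it is measurable since it coincides with an explicit
    measurable function outside of the points 0, pi / 2 and pi. *)
Lemma curve_density_integrable (w : R -> R -> R) (p : R -> R) (r : R) :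
  C1_on 0 (pi / 2) p -> r \in `[0, 1] ->
  leb.-integrable `[0, pi] (EFin \o w r) ->
  leb.-integrable `[0, pi] (EFin \o curve_density w p r) /\
  exists2 rho : R -> R, continuous rho &
    forall phi, phi \in `[0, pi] -> curve_radius p r phi = rho phi.
Proof.
move=> C1p; rewrite in_itv/= => /andP[r0 r1] iw.
have pi0 := pi_gt0 R.
have pi20 : 0 <= pi / 2 :> R by lra.
have [dp [cdp cp pdp]] := C1_on_continuous_derivable C1p.
have [u [v [cu mv v1 uE dv]]] := curve_angle r0 r1.
pose q : R -> R := p \o clamp 0 (pi / 2).
pose dq : R -> R := dp \o clamp 0 (pi / 2).
have cq : continuous q by exact: continuous_clamped.
have cdq : continuous dq by exact: continuous_clamped.
pose rho (phi : R) : R := q (u phi).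
pose drho (phi : R) : R := dq (u phi) * v phi.
have crho : continuous rho by exact: continuous_real_comp.
have cdru : continuous (fun phi => dq (u phi)).
  exact: continuous_real_comp.
have asin0 : asin 0 = 0 :> R.
  have z : 0 \in `[- (pi / 2), pi / 2 : R] by rewrite in_itv/=; lra.
  by have := sinK z; rewrite sin0.
have asin1 : asin 1 = pi / 2 :> R.
  have z : pi / 2 \in `[- (pi / 2), pi / 2 : R] by rewrite in_itv/=; lra.
  by have := sinK z; rewrite sin_pihalf.
have asin_itv phi : phi \in `[0, pi] -> asin (r * sin phi) \in `[0, pi / 2].
  move=> /(scaled_sin_itv r0 r1)/andP[x0 x1]; rewrite in_itv/=.
  rewrite asin_lepi2 ?andbT; last by lra.
  have [->|n0] := eqVneq (r * sin phi) 0.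
    by rewrite asin0; lra.
  have [->|n1] := eqVneq (r * sin phi) 1.
    by rewrite asin1; lra.
  have {}x0 : 0 < r * sin phi by rewrite lt_neqAle eq_sym n0.
  have {}x1 : r * sin phi < 1 by rewrite lt_neqAle n1.
  have := @asin_pos _ (r * sin phi); rewrite x0 x1 => /(_ isT).
  by rewrite in_itv/= => /andP[/ltW].
have rhoE phi : phi \in `[0, pi] -> curve_radius p r phi = rho phi.
  by move=> ph; rewrite /curve_radius /rho /q /= uE// clamp_id// asin_itv.
split; last by exists rho.
have drhoE phi : phi \in `]0, pi[ -> phi != pi / 2 ->
    derive1 (curve_radius p r) phi = drho phi.
  move=> ph pn; rewrite derive1E.
  have phc : phi \in `[0, pi] by exact: subset_itv_oo_cc.
  have D := dv _ ph pn.
  (* For r = 0 the radius is constant, while p may have no two-sided derivative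
     at the angle 0. *)
  have [x0|xn] := eqVneq r 0.
    have -> : curve_radius p r = cst (p (asin 0)).
      by apply/funext => s; rewrite /curve_radius x0 mul0r.
    rewrite derive_cst.
    have [_ v0] : is_derive phi 1 (cst (asin 0)) (v phi).
      rewrite (_ : cst (asin 0) = (fun s => asin (r * sin s)))//.
      by apply/funext => s; rewrite x0 mul0r.
    by rewrite /drho -v0 derive_cst mulr0.
  have /andP[sx0 sx1] := scaled_sin_lt1 r0 r1 ph pn.
  have ui : asin (r * sin phi) \in `]0, pi / 2[.
    apply: asin_pos; rewrite sx1 andbT mulr_gt0//.
      by rewrite lt_neqAle eq_sym xn.
    by apply: sin_gt0_pi; rewrite in_itv in ph.
  have [_ ->] := @is_derive1_comp _ p _ phi _ _ (pdp _ ui) D.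
  rewrite /drho /dq /= uE// clamp_id//.
  exact: asin_itv.
pose B phi := rho phi * sin phi * Num.sqrt (rho phi ^+ 2 + drho phi ^+ 2).
have [M1 M10 M1P] := continuous_rectangle_bounded 0 0 0 pi
  (K := fun _ phi => rho phi) (ltac:(continuity)).
have [M2 M20 M2P] := continuous_rectangle_bounded 0 0 0 pi
  (K := fun _ phi => dq (u phi)) (ltac:(continuity)).
have mB : measurable_fun setT B.
  apply: measurable_funM.
    apply: measurable_funM; first exact: continuous_measurable_fun.
    by apply: continuous_measurable_fun; continuity.
  apply: measurableT_comp.
    by apply: continuous_measurable_fun; exact: sqrt_continuous.
  apply: measurable_funD; apply: measurable_funX.
    exact: continuous_measurable_fun.
  apply: measurable_funM => //; exact: continuous_measurable_fun.
have BM phi : phi \in `[0, pi] -> `|B phi| <= M1 * (M1 + M2).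
  move=> ph; have z0 : 0 \in `[0, 0 : R] by rewrite in_itv/= lexx.
  have h1 := M1P 0 phi z0 ph; have h2 := M2P 0 phi z0 ph.
  have h3 : `|drho phi| <= M2.
    by rewrite normrM -[leRHS]mulr1 ler_pM.
  rewrite !normrM ler_pM// ?mulr_ge0//.
    rewrite -[leRHS]mulr1 ler_pM//.
    by rewrite ler_norml sin_geN1 sin_le1.
  rewrite ger0_norm ?sqrtr_ge0// -[leRHS]ger0_norm ?addr_ge0// -sqrtr_sqr.
  rewrite ler_sqrt ?sqr_ge0// -real_normK ?num_real//.
  rewrite -[drho phi ^+ 2]real_normK ?num_real//.
  by have := normr_ge0 (rho phi); have := normr_ge0 (drho phi); nra.
have := integrable_bounded_mul iw mB BM.
(* The points where [drho] is not the derivative of the radius. *)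
move=> /(integrable_modify_point 0 (curve_density w p r 0)).
move=> /(integrable_modify_point (pi / 2) (curve_density w p r (pi / 2))).
move=> /(integrable_modify_point pi (curve_density w p r pi)).
apply: eq_integrable => // phi /set_mem ph /=; congr _%:E.
have [->//|n1] := eqVneq phi pi.
have [->//|n2] := eqVneq phi (pi / 2).
have [->//|n3] := eqVneq phi 0.
rewrite /curve_density rhoE// drhoE ?mulrA//.
move: ph; rewrite /= !in_itv/= => /andP[a b].
by rewrite !lt_neqAle a b n1 eq_sym n3.
Qed.

End density.

(** * The harmonic coefficients of the spindle transform *)

Section assembly.
Context {R : realType}.
Local Notation leb := (@lebesgue_measure R).
Local Notation C := R[i].
Implicit Types f : 'cV[R]_3 -> R.

Definition dilated f (rho x y z : R) : R := f (vec3 (rho * x) (rho * y) (rho * z)).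

Lemma C1_space_dilated f rho : smooth f -> C1_space (dilated f rho).
Proof.
move=> /smooth_C1_space[g1 [g2 [g3 [cg c1 c2 c3 dg]]]].
exists (fun x y z => rho * g1 (rho * x) (rho * y) (rho * z)),
  (fun x y z => rho * g2 (rho * x) (rho * y) (rho * z)),
  (fun x y z => rho * g3 (rho * x) (rho * y) (rho * z)).
split; rewrite /dilated.
- apply: (continuous_comp3 (K := fun x y z => f (vec3 x y z)) cg); by continuity.
- by continuity.
- by continuity.
- by continuity.
move=> x y z t dx dy dz Dx Dy Dz.
have Ds (s : R -> R) ds : is_derive t 1 s ds ->
    is_derive t 1 (fun u => rho * s u) (0 * s t + rho * ds).
  by move=> D; apply: is_derive_mulr => //; exact: is_derive_cstr.
apply: is_derive_eq (dg _ _ _ t _ _ _ (Ds _ _ Dx) (Ds _ _ Dy) (Ds _ _ Dz)) _.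
by ring.
Qed.

Lemma continuous_dilated f : continuous f ->
  continuous (fun v : R * R * R * R => dilated f v.1.1.1 v.1.1.2 v.1.2 v.2).
Proof.
move=> cf; have cg : continuous (fun v : R * R * R => f (vec3 v.1.1 v.1.2 v.2)).
  move=> v; apply: (@continuous_comp _ _ _
    (fun v : R * R * R => vec3 v.1.1 v.1.2 v.2) f); last exact: cf.
  exact: continuous_vec3.
rewrite /dilated.
by apply: (continuous_comp3 (K := fun x y z => f (vec3 x y z)) cg); continuity.
Qed.

Lemma polar_form_dilated f (rho theta phi : R) : polar_form f rho theta phi =
  dilated f rho (cos theta * sin phi) (sin theta * sin phi) (cos phi).
Proof.
rewrite /polar_form /dilated; congr f; apply/matrixP => i j; rewrite !mxE.
by case: i => [[|[|[|]]]]//= _; ring.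
Qed.

Lemma polar_form_act_dilated f (a b rho theta phi : R) :
  polar_form (act (rotU a *m rotV b) f) rho theta phi =
  on_orbit (dilated f rho) a b theta phi.
Proof.
rewrite /polar_form /act /on_orbit /dilated; congr f.
apply/matrixP => i j; rewrite -mulmxA !mxE.
rewrite !big_ord_recl big_ord0 !mxE !big_ord_recl !big_ord0 !mxE /=.
rewrite /orbit_x /orbit_y /orbit_z.
by case: i => [[|[|[|]]]]//= _; ring.
Qed.

(** The integral over the colatitude along the curve is moved outside of the
    others; for each colatitude the radius is then constant. *)
Lemma spindle_funk_hecke f (D rho : R -> R) l j (mu : C) :
  smooth f -> leb.-integrable `[0, pi] (EFin \o D) -> continuous rho ->
  (j <= l.*2)%N ->
  let k a b := complex.Re (mu * solid_harm l j
    (cos a * sin b) (sin a * sin b) (cos b)) in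
  \int[leb]_(a in `[0, 2 * pi]) \int[leb]_(b in `[0, pi])
    ((\int[leb]_(h in `[0, 2 * pi]) \int[leb]_(phi in `[0, pi])
        (D phi * on_orbit (dilated f (rho phi)) a b h phi))
      * (k a b * sin b)) =
  2 * pi * \int[leb]_(phi in `[0, pi])
    (D phi * (\int[leb]_(a in `[0, 2 * pi]) \int[leb]_(b in `[0, pi])
      (dilated f (rho phi) (cos a * sin b) (sin a * sin b) (cos b)
        * (k a b * sin b))) * (legendre l).[cos phi]).
Proof.
move=> sf iD crho jl k.
have cf : continuous f := (sf [::]).1.
have cd := continuous_dilated cf.
have ck : continuous (fun v : R * R => k v.1 v.2).
  have [? [? [? [cK _ _ _ _]]]] := C1_solid_harm mu jl.
  rewrite /k; apply: (continuous_comp3 (K := fun x y z =>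
    complex.Re (mu * solid_harm l j x y z)) cK); by continuity.
pose A a b phi := \int[leb]_(h in `[0, 2 * pi])
  on_orbit (dilated f (rho phi)) a b h phi.
pose O a b h phi := on_orbit (dilated f (rho phi)) a b h phi.
have cO : continuous (fun v : R * R * R * R => O v.1.1.1 v.1.1.2 v.1.2 v.2).
  by rewrite /O /on_orbit /orbit_x /orbit_y /orbit_z; continuity.
have cA : continuous (fun v : R * R * R => A v.1.1 v.1.2 v.2).
  rewrite (_ : (fun v => _) = (fun v : R * R * R =>
    \int[leb]_(h in `[0, 2 * pi]) O v.1.1 v.1.2 h v.2))//.
  by continuity.
transitivity (\int[leb]_(a in `[0, 2 * pi]) \int[leb]_(b in `[0, pi])
    \int[leb]_(phi in `[0, pi]) (D phi * (A a b phi * (k a b * sin b)))).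
  apply: eq_Rintegral => a _; apply: eq_Rintegral => b _.
  rewrite (@Rintegral_weighted_swap _ 0 (2 * pi) 0 pi D
    (fun h phi => O a b h phi))//; last by continuity.
  rewrite -RintegralZr//; last first.
    by apply: integrable_weighted => //; continuity.
  by apply: eq_Rintegral => phi _; rewrite [RHS]mulrA.
transitivity (\int[leb]_(phi in `[0, pi]) (D phi *
    \int[leb]_(a in `[0, 2 * pi]) \int[leb]_(b in `[0, pi])
      (A a b phi * (k a b * sin b)))).
  pose B a phi := \int[leb]_(b in `[0, pi]) (A a b phi * (k a b * sin b)).
  have cB : continuous (fun v : R * R => B v.1 v.2) by rewrite /B; continuity.
  rewrite -(Rintegral_weighted_swap 0 (2 * pi) iD cB).
  apply: eq_Rintegral => a _.
  by rewrite -Rintegral_weighted_swap//; continuity.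
have cP : continuous (fun phi : R => (legendre l).[cos phi]).
  move=> phi; apply: (@continuous_comp _ _ _ cos (fun c => (legendre l).[c])).
    exact: continuous_cos.
  exact: continuous_horner.
pose P (phi : R) := (legendre l).[cos phi].
have cP' : continuous P by [].
pose H phi := \int[leb]_(a in `[0, 2 * pi]) \int[leb]_(b in `[0, pi])
      (dilated f (rho phi) (cos a * sin b) (sin a * sin b) (cos b)
        * (k a b * sin b)).
have cH : continuous H by rewrite /H; continuity.
rewrite -RintegralZl//; last first.
  rewrite (_ : (fun phi => _) = (fun phi => D phi * (H phi * P phi))).
    by apply: integrable_weighted => //; continuity.
  by apply/funext => phi; rewrite mulrA.
apply: eq_Rintegral => phi /set_mem; rewrite /= in_itv/= => /andP[phi0 _].
rewrite /A funk_hecke//; last exact: C1_space_dilated.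
by rewrite -/(H phi) -/(P phi); ring.
Qed.

Lemma Re_integrand (nu w : C) (x y : R) :
  complex.Re (nu * (x%:C * w * y%:C)) = x * (complex.Re (nu * w) * y).
Proof. by case: nu w => a b [c d]; rewrite !Re_mul /=; ring. Qed.

(** The weight [sin b] of the surface measure makes the poles, where the
    comparison with solid harmonics is not made, irrelevant. *)
Lemma sphere_Rintegral_sph_harm l (m : int) (nu mu : C) (g : R -> R -> R) :
  continuous (fun v : R * R => g v.1 v.2) -> (absz m <= l)%N ->
  (forall theta phi : R, phi \in `[0, pi] -> sin phi != 0 ->
    complex.Re (nu * Num.conj (sph_harm l m theta phi)) =
    complex.Re (mu * solid_harm l (l + absz m)
      (cos theta * sin phi) (sin theta * sin phi) (cos phi))) ->
  \int[(leb \x leb)%E]_(z in `[0, 2 * pi] `*` `[0, pi])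
    complex.Re (nu * ((g z.1 z.2)%:C * Num.conj (sph_harm l m z.1 z.2)
      * (sin z.2)%:C)) =
  \int[leb]_(a in `[0, 2 * pi]) \int[leb]_(b in `[0, pi])
    (g a b * (complex.Re (mu * solid_harm l (l + absz m)
      (cos a * sin b) (sin a * sin b) (cos b)) * sin b)).
Proof.
move=> cg ml muE.
have jl : (l + absz m <= l.*2)%N by rewrite -addnn leq_add2l.
have [? [? [? [cK _ _ _ _]]]] := C1_solid_harm mu jl.
pose k (a b : R) := complex.Re (mu * solid_harm l (l + absz m)
      (cos a * sin b) (sin a * sin b) (cos b)).
have ck : continuous (fun v : R * R => k v.1 v.2).
  rewrite /k; apply: (continuous_comp3 (K := fun x y z =>
    complex.Re (mu * solid_harm l (l + absz m) x y z)) cK); by continuity.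
rewrite -(@Rintegral_rectangle _ _ _ _ _ (fun a b => g a b * (k a b * sin b))).
  apply: eq_Rintegral => -[a b] /set_mem[_ /= bp]; rewrite Re_integrand.
  have [->|s0] := eqVneq (sin b) 0; first by rewrite !mulr0.
  by rewrite muE.
by continuity.
Qed.

(** The factor [nu] selects the real part (1) or the imaginary part (- 'i) of
    the harmonic coefficients. *)
Lemma spindle_component (f : 'cV[R]_3 -> R) (p : R -> R) (w : R -> R -> R)
    (r : R) l (m : int) (nu : C) :
  smooth f -> C1_on 0 (pi / 2) p -> r \in `[0, 1] ->
  leb.-integrable `[0, pi] (EFin \o w r) -> (absz m <= l)%N ->
  let component g := \int[(leb \x leb)%E]_(z in `[0, 2 * pi] `*` `[0, pi])
    complex.Re (nu * ((g z.1 z.2)%:C * Num.conj (sph_harm l m z.1 z.2)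
      * (sin z.2)%:C)) in
  component (spindle w p f r) =
  2 * pi * \int[leb]_(phi in `[0, pi]) (curve_density w p r phi
    * component (polar_form f (curve_radius p r phi)) * (legendre l).[cos phi]).
Proof.
move=> sf C1p r01 iw ml component.
have [mu muE] := Re_conj_sph_harm l m nu.
have jl : (l + absz m <= l.*2)%N by rewrite -addnn leq_add2l.
have [iD [rho crho rhoE]] := curve_density_integrable C1p r01 iw.
have cf : continuous f := (sf [::]).1.
have cd := continuous_dilated cf.
pose S a b := \int[leb]_(h in `[0, 2 * pi]) \int[leb]_(phi in `[0, pi])
  (curve_density w p r phi * on_orbit (dilated f (rho phi)) a b h phi).
have spindleE : spindle w p f r = S.
  apply/funext => a; apply/funext => b; rewrite /spindle /S.
  apply: eq_Rintegral => h _; apply: eq_Rintegral => phi /set_mem ph.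
  by rewrite polar_form_act_dilated rhoE.
have cS : continuous (fun v : R * R => S v.1 v.2).
  pose O a b h phi := on_orbit (dilated f (rho phi)) a b h phi.
  have cO : continuous (fun v : R * R * R * R => O v.1.1.1 v.1.1.2 v.1.2 v.2).
    by rewrite /O /on_orbit /orbit_x /orbit_y /orbit_z; continuity.
  rewrite (_ : (fun v => _) = (fun v => \int[leb]_(phi in `[0, pi])
      (curve_density w p r phi * \int[leb]_(h in `[0, 2 * pi]) O v.1 v.2 h phi))).
    by apply: continuous_Rintegral_param => //; continuity.
  apply/funext => v.
  by rewrite -(@Rintegral_weighted_swap _ _ _ _ _ _ (O v.1 v.2))//; continuity.
rewrite /component spindleE (sphere_Rintegral_sph_harm cS ml muE).
rewrite (spindle_funk_hecke mu sf iD crho jl); congr (_ * _).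
apply: eq_Rintegral => phi /set_mem ph; congr (_ * _ * _).
have cg : continuous (fun v : R * R => polar_form f (rho phi) v.1 v.2).
  rewrite (_ : (fun v => _) = (fun v : R * R => dilated f (rho phi)
    (cos v.1 * sin v.2) (sin v.1 * sin v.2) (cos v.2))).
    by continuity.
  by apply/funext => v; rewrite polar_form_dilated.
rewrite (rhoE phi ph) (sphere_Rintegral_sph_harm cg ml muE).
apply: eq_Rintegral => a _; apply: eq_Rintegral => b _.
by rewrite polar_form_dilated.
Qed.

Lemma Re_harm_coef l (m : int) (g : R -> R -> R) :
  complex.Re (harm_coef l m g) =
  \int[(leb \x leb)%E]_(z in `[0, 2 * pi] `*` `[0, pi])
    complex.Re (1 * ((g z.1 z.2)%:C * Num.conj (sph_harm l m z.1 z.2)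
      * (sin z.2)%:C)).
Proof. by apply: eq_Rintegral => z _; rewrite mul1r. Qed.

Lemma Im_harm_coef l (m : int) (g : R -> R -> R) :
  complex.Im (harm_coef l m g) =
  \int[(leb \x leb)%E]_(z in `[0, 2 * pi] `*` `[0, pi])
    complex.Re (- 'i * ((g z.1 z.2)%:C * Num.conj (sph_harm l m z.1 z.2)
      * (sin z.2)%:C)).
Proof.
have ImE (w : C) : complex.Im w = complex.Re (- 'i * w).
  by case: w => a b; rewrite Re_mul /=; ring.
by apply: eq_Rintegral => z _; rewrite -ImE.
Qed.

End assembly.
Theorem lemma1 (R : realType) (f : 'cV[R]_3 -> R) (p : R -> R)
    (w : R -> R -> R)
    (f_smooth : smooth f) (f_supp : compactly_supported f)
    (p_C1 : C1_on 0 (pi / 2) p)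
    (p_ge0 : forall x, x \in `[0, pi / 2] -> 0 <= p x)
    (w_int : forall r, r \in `[0, 1] ->
      (@lebesgue_measure R).-integrable `[0, pi] (EFin \o w r))
    (r : R) (r01 : r \in `[0, 1])
    (l : nat) (m : int) (ml : (absz m <= l)%N) :
  harm_coef l m (spindle w p f r) =
  (2 * pi)%:C *
  Cintegral (@lebesgue_measure R) `[0, pi]
    (fun phi => (curve_density w p r phi)%:C
                * harm_coef l m (polar_form f (curve_radius p r phi))
                * ((legendre l).[cos phi])%:C).
Proof.
have wr := w_int r r01.
have scaled (k : R) (z : R[i]) : complex.Re (k%:C * z) = k * complex.Re z
    /\ complex.Im (k%:C * z) = k * complex.Im z.
  by case: z => a b; rewrite /= !mul0r subr0 addr0.
have scaled_r (k : R) (z : R[i]) : complex.Re (z * k%:C) = complex.Re z * k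
    /\ complex.Im (z * k%:C) = complex.Im z * k.
  by case: z => a b; rewrite /= !mulr0 subr0 add0r.
apply/eqP; rewrite eq_complex (scaled _ _).1 (scaled _ _).2.
apply/andP; split; apply/eqP.
  rewrite Re_harm_coef spindle_component//; congr (_ * _).
  apply: eq_Rintegral => phi _.
  by rewrite (scaled_r _ _).1 (scaled _ _).1 Re_harm_coef.
rewrite Im_harm_coef spindle_component//; congr (_ * _).
apply: eq_Rintegral => phi _.
by rewrite (scaled_r _ _).2 (scaled _ _).2 Im_harm_coef.
Qed.
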